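(* Consider the augmented Nash equilibrium problem in which, for $\nu=1,\dots,N$, player $\nu$ solves $$\min_{u^\nu\in L^2(\Omega)}\ f_\nu^{AL}(u,\mu,\rho):=\frac12\|Su-y_d^\nu\|_{L^2(\Omega_\nu)}^2+\frac{\alpha}{2}\|u^\nu\|_{L^2(\Omega)}^2+\frac{1}{2\rho}\big\|(\mu+\rho(Su-\psi))_+\big\|_{L^2(\Omega)}^2\quad\text{s.t. }u^\nu\in U_{\mathrm{ad}}^\nu .$$ (i) If $$\alpha > \frac14 \sum_{\nu=1}^N \big\| \chi_Z (S_\nu - \chi_\nu S_\nu)\big\|_{L^2(\Omega)\to L^2(\Omega)}^2 ,$$ then this problem has a unique solution. (ii) If $\Omega_\nu=\Omega_0\subseteq\Omega$ for all $\nu=1,\dots,N$, then this problem is uniquely solvable for all $\alpha>0$.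
   Context: Let $\Omega\subset\mathbb{R}^n$, $n\in\{1,2,3\}$, be a bounded Lipschitz domain, $N\in\mathbb{N}$ the number of players, and $U:=L^2(\Omega)^N$. Elements of $U$ are written $u=(u^1,\dots,u^N)=(u^\nu,u^{-\nu})$, where $u^{-\nu}$ collects all components except the $\nu$-th. Given $u_a^\nu,u_b^\nu\in L^2(\Omega)$ with $u_a^\nu\le u_b^\nu$ a.e., set $U_{\mathrm{ad}}^\nu:=\{u^\nu\in L^2(\Omega): u_a^\nu(x)\le u^\nu(x)\le u_b^\nu(x)\text{ for a.e. }x\in\Omega\}$ and $U_{\mathrm{ad}}:=U_{\mathrm{ad}}^1\times\dots\times U_{\mathrm{ad}}^N$. Let $y_d^\nu\in L^2(\Omega)$, $\psi\in C(\bar\Omega)$, $\mu\in L^2(\Omega)$ with $\mu\ge0$, and $\alpha,\rho>0$. $(\cdot)_+:=\max(\cdot,0)$ pointwise a.e. Let $Y$ be a state space continuously embedded in $L^q(\Omega)$ for some $q>2$, and let $A:Y\to H^{-1}(\Omega)$ be linear, bounded and continuously invertible (a linear elliptic operator). Set $S_\nu:=A^{-1}:H^{-1}(\Omega)\to Y\hookrightarrow L^q(\Omega)$ for every $\nu$ and $Su:=A^{-1}\sum_{\nu=1}^N u^\nu=\sum_{\nu=1}^N S_\nu u^\nu$. Via $L^2(\Omega)\hookrightarrow H^{-1}(\Omega)$ and $L^q(\Omega)\hookrightarrow L^2(\Omega)$, $S_\nu$ is also regarded as a bounded operator on $L^2(\Omega)$. Let $\Omega_\nu\subseteq\Omega$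 be measurable for $\nu=1,\dots,N$, let $\chi_\nu$ be the characteristic function of $\Omega_\nu$, $Z:=\bigcup_{\nu=1}^N\Omega_\nu$, and $\chi_Z$ the characteristic function of $Z$. Multiplication by a characteristic function is regarded as an operator on $L^2(\Omega)$. A solution of the Nash equilibrium problem is a point $\bar u\in U_{\mathrm{ad}}$ such that for every $\nu$, $f_\nu^{AL}((\bar u^\nu,\bar u^{-\nu}),\mu,\rho)\le f_\nu^{AL}((v^\nu,\bar u^{-\nu}),\mu,\rho)$ for all $v^\nu\in U_{\mathrm{ad}}^\nu$. *)

(* Defs.v *)
From HB Require Import structures.
From mathcomp Require Import all_boot all_order all_algebra.
From mathcomp Require Import all_classical all_reals all_analysis.
From mathcomp Require Import measurable_realfun ess_sup_inf.
From mathcomp Require Import ring lra.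
Set Implicit Arguments.
Unset Strict Implicit.
Unset Printing Implicit Defensive.
Import Order.TTheory GRing.Theory Num.Theory.
Import numFieldNormedType.Exports.
Local Open Scope classical_set_scope.
Local Open Scope ring_scope.

Section Lspace_normed.
Context d (T : measurableType d) (R : realType).
Variables (mu : {measure set T -> \bar R}) (p : \bar R) (p1 : (1 <= p)%E).
Local Notation L := (LspaceType mu p1).
Local Notation F := (LfunType mu p1).

Local Open Scope quotient_scope.

Lemma Lspace_eqP (u v : L) : (u : T -> R) = v %[ae mu] -> u = v.
Proof.
case: u v => [u [[hu]]] [v [[hv]]] /= uv.
have e : u = v.
  rewrite -[u]reprK -[v]reprK; apply/eqmodP => /=.
  exact/asboolP.
by subst v; rewrite (Prop_irrelevance hu hv).
Qed.

Lemma Lspace_Lfun (u : L) : (u : T -> R) \in Lfun mu p.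
Proof.
apply/andP; split; rewrite inE /=; last exact: Lebesgue_finite.
exact: (@measurable_funPT _ _ _ _ (repr (u : {mfun_ mu, T >-> measurableTypeR R}))).
Qed.

Definition Lrep (u : L) : F := Lfun_Sub p1 (Lspace_Lfun u).

Lemma ae_Lnorm (f g : {mfun T >-> measurableTypeR R}) : (f : T -> R) = g %[ae mu] ->
  ('N[mu]_p[EFin \o f] = 'N[mu]_p[EFin \o g])%E.
Proof.
move=> fg; rewrite unlock; case: p p1 => [r r1|_|//] /=.
- congr (_ `^ _)%E; apply: ae_eq_integral => //.
  + apply/measurable_EFinP; apply: (measurableT_comp (measurable_powR _)).
    exact: measurableT_comp.
  + apply/measurable_EFinP; apply: (measurableT_comp (measurable_powR _)).
    exact: measurableT_comp.
  + by apply: filterS fg => x /= /(_ I) -> _.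
- case: ifPn => // _; apply: eq_ess_sup.
  by apply: filterS fg => x /= /(_ I) ->.
Qed.

Let Lfun_measurable (f : F) : measurable_fun [set: T] (f : T -> measurableTypeR R).
Proof. exact: (measurable_funPT (f : {mfun T >-> R})). Qed.

Definition Lfun_mfun (f : F) : {mfun T >-> measurableTypeR R} :=
  MeasurableFun.Pack (MeasurableFun.Class (@isMeasurableFun.Axioms_ _ _ _ _ _ (Lfun_measurable f))).


Let qcls (f : F) : {mfun_ mu, T >-> measurableTypeR R} :=
  \pi_({mfun_ mu, T >-> measurableTypeR R}) (Lfun_mfun f).

Let qcls_ae (f : F) : (qcls f : T -> R) = f %[ae mu].
Proof.
apply/asboolP; rewrite -[X in is_true X]/(ae_eq_op mu (repr (qcls f)) (Lfun_mfun f)).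
by rewrite -[ae_eq_op _ _ _]eqmodE; apply/eqP; rewrite reprK.
Qed.

Let qcls_finite (f : F) : finite_norm mu p (qcls f).
Proof.
rewrite /finite_norm (@ae_Lnorm (repr (qcls f)) (Lfun_mfun f)); last exact: qcls_ae.
exact: Lfunction_finite.
Qed.

Definition Lcls (f : F) : L := LebesgueSpace.Pack
  (LebesgueSpace.Class (@isFinLebesgue.Axioms_ d T R mu p p1 (qcls f) (qcls_finite f))).

Lemma LclsE f : (Lcls f : T -> R) = f %[ae mu].
Proof. exact: qcls_ae. Qed.

Lemma ae_Lcls (f g : F) : (f : T -> R) = g %[ae mu] -> Lcls f = Lcls g.
Proof.
move=> fg; apply: Lspace_eqP; apply: (ae_eq_trans (LclsE f)).
exact: (ae_eq_trans fg (ae_eq_sym (LclsE g))).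
Qed.

Lemma LrepK u : Lcls (Lrep u) = u.
Proof. by apply: Lspace_eqP; exact: LclsE. Qed.

Lemma LrepE (f : F) : (Lrep (Lcls f) : T -> R) = f %[ae mu].
Proof. exact: LclsE. Qed.

Definition Ladd (u v : L) := Lcls (Lrep u + Lrep v).
Definition Lopp (u : L) := Lcls (- Lrep u).
Definition Lscale (a : R) (u : L) := Lcls (a *: Lrep u).
Definition Lnrm (u : L) : R := fine ('N[mu]_p[EFin \o u])%E.


Let Lcls_surj (P : L -> Prop) : (forall f, P (Lcls f)) -> forall u, P u.
Proof. by move=> h u; rewrite -(LrepK u). Qed.

Lemma Lcls_add (f g : F) : Ladd (Lcls f) (Lcls g) = Lcls (f + g).
Proof.
apply: ae_Lcls; apply: filterS2 (LrepE f) (LrepE g) => x /= /(_ I) h1 /(_ I) h2 _.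
by rewrite /GRing.add /= h1 h2.
Qed.

Lemma Lcls_opp (f : F) : Lopp (Lcls f) = Lcls (- f).
Proof.
apply: ae_Lcls; apply: filterS (LrepE f) => x /= /(_ I) h1 _.
by rewrite /GRing.opp /= h1.
Qed.

Lemma Lcls_scale (a : R) (f : F) : Lscale a (Lcls f) = Lcls (a *: f).
Proof.
apply: ae_Lcls; apply: filterS (LrepE f) => x /= /(_ I) h1 _.
by rewrite /GRing.scale /= h1.
Qed.

Lemma Lcls_norm (f : F) : Lnrm (Lcls f) = fine ('N[mu]_p[EFin \o f])%E.
Proof.
congr fine.
exact: (@ae_Lnorm (Lfun_mfun (Lrep (Lcls f))) (Lfun_mfun f) (LclsE f)).
Qed.

HB.instance Definition _ := gen_eqMixin L.
HB.instance Definition _ := gen_choiceMixin L.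

Let LaddA : associative Ladd.
Proof.
by elim/Lcls_surj=> f; elim/Lcls_surj=> g; elim/Lcls_surj=> h;
  rewrite !Lcls_add addrA.
Qed.

Let LaddC : commutative Ladd.
Proof. by elim/Lcls_surj=> f; elim/Lcls_surj=> g; rewrite !Lcls_add addrC. Qed.

Let Ladd0 : left_id (Lcls 0) Ladd.
Proof. by elim/Lcls_surj=> f; rewrite Lcls_add add0r. Qed.

Let LaddN : left_inverse (Lcls 0) Lopp Ladd.
Proof. by elim/Lcls_surj=> f; rewrite Lcls_opp Lcls_add addNr. Qed.

HB.instance Definition _ := GRing.isZmodule.Build L LaddA LaddC Ladd0 LaddN.

Let LscaleA a b u : Lscale a (Lscale b u) = Lscale (a * b) u.
Proof. by elim/Lcls_surj: u => f; rewrite !Lcls_scale scalerA. Qed.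

Let Lscale1 : left_id 1 Lscale.
Proof. by elim/Lcls_surj=> f; rewrite Lcls_scale scale1r. Qed.

Let LscaleDr : right_distributive Lscale +%R.
Proof.
move=> a; elim/Lcls_surj=> f; elim/Lcls_surj=> g.
by rewrite [_ + _]Lcls_add !Lcls_scale [RHS]Lcls_add scalerDr.
Qed.

Let LscaleDl u : {morph Lscale ^~ u : a b / a + b}.
Proof.
move=> a b; elim/Lcls_surj: u => f.
by rewrite !Lcls_scale [RHS]Lcls_add scalerDl.
Qed.

HB.instance Definition _ :=
  GRing.Zmodule_isLmodule.Build R L LscaleA Lscale1 LscaleDr LscaleDl.

Let LnrmD (u v : L) : Lnrm (u + v) <= Lnrm u + Lnrm v.
Proof.
elim/Lcls_surj: u => f; elim/Lcls_surj: v => g.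
by rewrite [_ + _]Lcls_add !Lcls_norm; exact: ler_LnormD.
Qed.

Let LnrmZ (a : R) (u : L) : Lnrm (a *: u) = `|a| * Lnrm u.
Proof.
elim/Lcls_surj: u => f; rewrite [_ *: _]Lcls_scale !Lcls_norm.
apply: EFin_inj; rewrite EFinM !finite_norm_fine.
exact: LnormZ.
Qed.

Let Lnrm0_eq0 (u : L) : Lnrm u = 0 -> u = 0.
Proof.
elim/Lcls_surj: u => f; rewrite Lcls_norm => /fine_Lnormr_eq0 h.
exact: ae_Lcls.
Qed.

HB.instance Definition _ := Lmodule_isNormed.Build R L LnrmD LnrmZ Lnrm0_eq0.

Lemma LnormE (u : L) : `|u| = fine ('N[mu]_p[EFin \o u])%E.
Proof. by []. Qed.

Lemma Lspace_0E : (0 : L) = (cst 0 : T -> R) %[ae mu].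
Proof. by apply: filterS (LclsE 0) => x /(_ I). Qed.

Lemma Lspace_addE (u v : L) : (u + v : T -> R) = u \+ v %[ae mu].
Proof. by apply: filterS (LclsE (Lrep u + Lrep v)) => x /(_ I). Qed.

Lemma Lspace_scaleE a (u : L) : (a *: u : T -> R) = (fun x => a * u x) %[ae mu].
Proof. by apply: filterS (LclsE (a *: Lrep u)) => x /(_ I). Qed.

(* The class of f in L^p(mu), for any f that agrees almost everywhere with
   some element of L^p(mu); 0 if there is no such element. *)
Definition Lclass (f : T -> R) : L := xget 0 [set u : L | (u : T -> R) = f %[ae mu]].

Lemma LclassE (f g : T -> R) : g \in Lfun mu p -> g = f %[ae mu] ->
  (Lclass f : T -> R) = f %[ae mu].
Proof.
move=> gL gf; rewrite /Lclass; case: xgetP => // /(_ (Lcls (Lfun_Sub p1 gL))) [] /=.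
exact: (ae_eq_trans (LclsE (Lfun_Sub p1 gL)) gf).
Qed.

End Lspace_normed.
Arguments Lclass {d T R mu p p1} f.

Section lebesgue_rV.
Context (R : realType) (n : nat).
Local Notation V := 'rV[R]_n.+1.
Implicit Types (a b x : V) (X : set V).

Definition box (a b : V) : set V := [set x | forall i, a 0 i < x 0 i <= b 0 i].

Definition box_vol (a b : V) : R := \prod_i Num.max (b 0 i - a 0 i) 0.

Definition leb_outer (X : set V) : \bar R :=
  ereal_inf [set (\sum_(k <oo) (box_vol (A k).1 (A k).2)%:E)%E |
    A in [set A : nat -> V * V | X `<=` \bigcup_k box (A k).1 (A k).2]].

Lemma box_vol_ge0 a b : 0 <= box_vol a b.
Proof. by apply: prodr_ge0 => i _; rewrite le_max lexx orbT. Qed.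

Local Open Scope ereal_scope.

Let vol_ge0 (c : V * V) : 0 <= (box_vol c.1 c.2)%:E.
Proof. by rewrite lee_fin box_vol_ge0. Qed.

Let leb_outer_ge0 X : 0 <= leb_outer X.
Proof.
by apply: le_ereal_inf_tmp => x [A _ <-{x}]; apply: nneseries_ge0 => k _ _.
Qed.

Let le_leb_outer : {homo leb_outer : A B / A `<=` B >-> A <= B}.
Proof.
move=> A B AB; apply/ereal_inf_le_tmp => x [C BC <-{x}]; exists C => //.
exact: subset_trans AB BC.
Qed.

Let leb_outer0 : leb_outer set0 = 0.
Proof.
apply/eqP; rewrite eq_le leb_outer_ge0 andbT.
apply: ereal_inf_lbound; exists (fun=> (0%R, 0%R)) => //=.
rewrite eseries0 // => k _ _; congr EFin.
by rewrite /box_vol big_ord_recl subrr maxxx mul0r.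
Qed.

Let leb_outer_sigma_subadditive : sigma_subadditive leb_outer.
Proof.
move=> A; have [[i ioo]|] := pselect (exists i, leb_outer (A i) = +oo).
  rewrite (eseries_pinfty _ _ ioo) ?leey// => k _.
  by rewrite -ltNye (lt_le_trans _ (leb_outer_ge0 _)).
rewrite -forallNE => Aoo.
suff add2e (e : {posnum R}) :
    leb_outer (\bigcup_n A n) <= \sum_(i <oo) leb_outer (A i) + e%:num%:E.
  by apply/lee_addgt0Pr => _/posnumP[].
rewrite (le_trans _ (epsilon_trick _ _ _))//.
pose P k (B : nat -> V * V) := A k `<=` \bigcup_j box (B j).1 (B j).2 /\
  \sum_(j <oo) (box_vol (B j).1 (B j).2)%:E <=
    leb_outer (A k) + (e%:num / (2 ^ k.+1)%:R)%:E.
have [G PG] : {G : nat -> nat -> V * V & forall k, P k (G k)}.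
  apply: (@choice _ _ P) => k; rewrite /P /leb_outer.
  set S := (X in ereal_inf X); move infS : (ereal_inf S) => iS.
  case: iS infS => [r Sr|Soo|Soo].
  - have en1 : (0 < e%:num / (2 ^ k.+1)%:R)%R by [].
    have /(lb_ereal_inf_adherent en1) : ereal_inf S \is a fin_num by rewrite Sr.
    move=> [x [B AnB muBx] xS].
    by exists B; split => //; rewrite muBx -Sr; exact/ltW.
  - by have := Aoo k; rewrite /leb_outer Soo.
  - suff : lbound S 0 by move/le_ereal_inf_tmp; rewrite Soo.
    by move=> /= _ [B AnB <-]; exact: nneseries_ge0.
pose vol (c : V * V) := (box_vol c.1 c.2)%:E.
have volG_ge0 (x : nat * nat) : 0 <= (vol \o uncurry G) x by exact: vol_ge0.
apply: (@le_trans _ _ (\esum_(i in setT) (vol \o uncurry G) i)).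
  apply: ereal_inf_lbound => /=.
  have /card_esym/ppcard_eqP[f] := card_nat2.
  exists (uncurry G \o f).
    move=> t [i _] /(proj1 (PG i)) [j _ Bijt]; exists (f^-1%FUN (i, j)) => //=.
    by rewrite invK ?inE.
  rewrite -(esum_pred_image (vol \o uncurry G) _ xpredT) ?[fun=> _]set_true//.
  by rewrite image_eq.
rewrite (_ : esum _ _ = \sum_(i <oo) \sum_(j <oo ) vol (G i j)); last first.
  pose J : nat -> set (nat * nat) := fun i => [set (i, j) | j in setT].
  rewrite (_ : setT = \bigcup_k J k); last first.
    by rewrite predeqE => -[a b]; split => // _; exists a => //; exists b.
  rewrite esum_bigcupT /=; last 2 first.
    - apply/trivIsetP => i j _ _ ij.
      rewrite predeqE => -[k m] /=; split => //= -[] [_] _ [<-{k} _].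
      by move=> [m' _] [] /esym/eqP; rewrite (negbTE ij).
    - by move=> x; exact: volG_ge0.
  rewrite -(image_id [set: nat]) -fun_true esum_pred_image//; last first.
    by move=> k _; apply: esum_ge0 => x _; exact: vol_ge0.
  apply: eq_eseriesr => /= j _.
  rewrite -(esum_pred_image (vol \o uncurry G) (pair j) predT)//=; last 2 first.
    by move=> k _; exact: vol_ge0.
    by move=> ? ? _ _; exact: (@can_inj _ _ _ snd).
  by congr esum; rewrite predeqE => -[a b]; split; move=> [i _ <-]; exists i.
apply: lee_lim.
- apply: is_cvg_nneseries => k *.
  by apply: nneseries_ge0 => m *; exact: (volG_ge0 (k, m)).
- by apply: is_cvg_nneseries => k *; apply: adde_ge0.
- by near=> k; apply: lee_sum => i _; exact: (PG i).2.
Unshelve. all: by end_near. Qed.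

HB.instance Definition _ := isOuterMeasure.Build R V leb_outer
  leb_outer0 leb_outer_ge0 le_leb_outer leb_outer_sigma_subadditive.

(* The measurable subsets of R^n.+1 are the Lebesgue (Caratheodory) measurable
   ones. *)
HB.instance Definition _ :=
  Measurable.copy 'rV[R]_n.+1 (caratheodory_type leb_outer).

Definition leb : set 'rV[R]_n.+1 -> \bar R := leb_outer.

Let leb_sigma_additive : semi_sigma_additive leb.
Proof. exact: caratheodory_measure_sigma_additive. Qed.

HB.instance Definition _ := isMeasure.Build _ V R leb
  leb_outer0 leb_outer_ge0 leb_sigma_additive.

End lebesgue_rV.

Section lebesgue_rV_theory.
Context (R : realType) (n : nat).
Local Notation V := 'rV[R]_n.+1.

Let upd (b : V) i (c : R) : V := \row_j if j == i then c else b 0 j.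

Let max_min_split (a b c : R) :
  Num.max (Num.min b c - a) 0 + Num.max (b - Num.max a c) 0 = Num.max (b - a) 0.
Proof.
have [bc|cb] := leP b c; have [ac|ca] := leP a c.
- by rewrite (max_r (_ : b - c <= 0)) ?addr0 ?subr_le0.
- have ab : b <= a by exact: le_trans bc (ltW ca).
  by rewrite max_r ?addr0 ?subr_le0.
- rewrite !max_l ?subr_ge0 ?(ltW cb)//; last exact: le_trans ac (ltW cb).
  by rewrite addrC addrA subrK.
- by rewrite max_r ?add0r ?subr_le0 ?(ltW ca).
Qed.

Let box_vol_split (a b : V) i c :
  box_vol a (upd b i (Num.min (b 0 i) c)) + box_vol (upd a i (Num.max (a 0 i) c)) b =
  box_vol a b.
Proof.
rewrite /box_vol (bigD1 i)//= [X in _ + X](bigD1 i)//= [RHS](bigD1 i)//=.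
rewrite [upd _ _ _ 0 i]mxE eqxx [upd _ _ _ 0 i]mxE eqxx.
rewrite (eq_bigr (fun j => Num.max (b 0 j - a 0 j) 0)); last first.
  by move=> j /negPf ji; rewrite mxE ji.
rewrite [X in _ + _ * X](eq_bigr (fun j => Num.max (b 0 j - a 0 j) 0)); last first.
  by move=> j /negPf ji; rewrite mxE ji.
by rewrite -mulrDl max_min_split.
Qed.

Lemma measurable_halfspace (i : 'I_n.+1) (c : R) :
  measurable [set x : V | x 0 i <= c].
Proof.
apply: (@le_caratheodory_measurable _ _ (@leb_outer R n)) => X.
apply: le_ereal_inf_tmp => _ [A XA <-].
pose A1 k := ((A k).1, upd (A k).2 i (Num.min ((A k).2 0 i) c)).
pose A2 k := (upd (A k).1 i (Num.max ((A k).1 0 i) c), (A k).2).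
rewrite (eq_eseriesr (g := fun k => ((box_vol (A1 k).1 (A1 k).2)%:E +
  (box_vol (A2 k).1 (A2 k).2)%:E)%E)); last first.
  by move=> k _; rewrite -EFinD box_vol_split.
rewrite nneseriesD; try by move=> k _ _; rewrite lee_fin box_vol_ge0.
apply: leeD; apply: ereal_inf_lbound.
- exists A1 => // x [/XA[k _ xk] xc]; exists k => // j.
  have := xk j; rewrite /A1 /= mxE; case: eqP => [->|//] /andP[-> /=].
  by rewrite le_min => ->.
- exists A2 => // x [/XA[k _ xk] /= /negP]; rewrite -ltNge => xc; exists k => // j.
  have := xk j; rewrite /A2 /= mxE; case: eqP => [->|//] /andP[+ ->].
  by rewrite gt_max => ->; rewrite xc.
Qed.

Lemma measurable_box (a b : V) : measurable (box a b).
Proof.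
rewrite (_ : box a b = \bigcap_(i in [set: 'I_n.+1])
  ([set x : V | x 0 i <= b 0 i] `\` [set x : V | x 0 i <= a 0 i])); last first.
  apply/seteqP; split => [x xab i _|x xab i].
    by have /andP[ax xb] := xab i; split => //=; apply/negP; rewrite -ltNge.
  by have [/= -> /negP] := xab i I; rewrite -ltNge => ->.
apply: fin_bigcap_measurable => [|i _]; first exact: finite_finset.
by apply: measurableD; exact: measurable_halfspace.
Qed.

Lemma open_measurable_rV (U : set V) : open U -> measurable U.
Proof.
move=> oU.
pose B (k : nat) : set V := if unpickle k is Some ab then
  (let Q := box (map_mx ratr (ab : 'rV[rat]_n.+1 * 'rV[rat]_n.+1).1)
     (map_mx ratr ab.2) in if `[< Q `<=` U >] then Q else set0) else set0.
rewrite (_ : U = \bigcup_k B k).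
  apply: bigcupT_measurable => k; rewrite /B; case: unpickle => // ab.
  by case: ifP => // _; exact: measurable_box.
apply/seteqP; split=> [x Ux|x [k _]]; last first.
  by rewrite /B; case: unpickle => // ab; case: asboolP => // QU /QU.
have /nbhs_ballP[e /= e0 xeU] : nbhs x U by exact: open_nbhs_nbhs.
have ex_a i : exists q : rat, x 0 i - e < ratr q < x 0 i.
  have [q] := @rat_in_itvoo R (x 0 i - e) (x 0 i) ltac:(lra).
  by rewrite in_itv; exists q.
have ex_b i : exists q : rat, x 0 i < ratr q < x 0 i + e.
  have [q] := @rat_in_itvoo R (x 0 i) (x 0 i + e) ltac:(lra).
  by rewrite in_itv; exists q.
have [a xa] := choice ex_a; have [b xb] := choice ex_b.
pose ab : 'rV[rat]_n.+1 * 'rV[rat]_n.+1 := (\row_i a i, \row_i b i).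
exists (pickle ab) => //; rewrite /B pickleK /=.
have -> : `[< box (map_mx (@ratr R) (\row_i a i)) (map_mx ratr (\row_i b i)) `<=` U >].
  apply/asboolP => y yab; apply: xeU; split=> // i j; rewrite ord1.
  have := yab j; have := xa j; have := xb j; rewrite !mxE.
  move=> /andP[? ?] /andP[? ?] /andP[? ?].
  by rewrite /ball /= ltr_norml; apply/andP; split; lra.
move=> i; rewrite !mxE; have /andP[_ ->] := xa i.
by have /andP[/ltW -> _] := xb i.
Qed.

End lebesgue_rV_theory.

Section domain.
Context (R : realType) (n : nat).
Local Notation V := 'rV[R]_n.+1.

(* Near every boundary point, after an orthogonal change of coordinates Q, Om is
   the region above the graph of a Lipschitz function g of the coordinates other
   than the k-th. *)
Definition lipschitz_boundary (Om : set V) := forall x0 : V,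
  (closure Om `\` Om^°) x0 ->
  exists (Q : 'M[R]_n.+1) (k : 'I_n.+1) (g : 'rV[R]_n -> R) (r : R),
    [/\ Q *m Q^T = 1%:M, [lipschitz g z | z in setT], 0 < r &
        forall x, ball x0 r x ->
          Om x <-> g (col' k (x *m Q)) < (x *m Q) 0 k].

Record lipschitz_domain := LipschitzDomain {
  lipdom_set :> set V;
  lipdom_nonempty : lipdom_set !=set0;
  lipdom_open : open lipdom_set;
  lipdom_connected : connected lipdom_set;
  lipdom_bounded : bounded_set lipdom_set;
  lipdom_boundary : lipschitz_boundary lipdom_set }.

(* Functions on Om are modelled by functions on the whole space, considered
   up to equality almost everywhere on Om. *)
Definition leb_on (Om : lipschitz_domain) : set V -> \bar R :=
  mrestr (@leb R n) (open_measurable_rV (@lipdom_open Om)).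
HB.instance Definition _ Om := Measure.on (leb_on Om).

Definition Lp (Om : lipschitz_domain) (q : \bar R) (q1 : (1 <= q)%E) :=
  LspaceType (leb_on Om) q1.

Definition L2 (Om : lipschitz_domain) := LspaceType2 (leb_on Om).
End domain.

Section sobolev.
Context (R : realType) (n : nat) (Om : lipschitz_domain R n).
Local Notation V := 'rV[R]_n.+1.
Local Notation L2 := (L2 Om).

Definition partial (i : 'I_n.+1) (f : V -> R) : V -> R := 'D_(delta_mx 0 i) f.

Fixpoint Ck (k : nat) (f : V -> R) : Prop :=
  continuous f /\
  if k is k'.+1 then
    forall i, (forall x, derivable f x (delta_mx 0 i)) /\ Ck k' (partial i f)
  else True.

Definition supp (f : V -> R) : set V := closure [set x | f x != 0].

Definition test_function (f : V -> R) :=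
  [/\ forall k, Ck k f, compact (supp f) & supp f `<=` Om].

Definition test_pair (w : L2 * ('I_n.+1 -> L2)) := exists f : V -> R,
  [/\ test_function f, (w.1 : V -> R) = f %[ae leb_on Om] &
      forall i, (w.2 i : V -> R) = partial i f %[ae leb_on Om]].

(* H^1_0(Om): the closure, in the H^1 norm, of the pairs (f, gradient of f)
   with f in C_c^oo(Om). *)
Definition H10_spec (w : L2 * ('I_n.+1 -> L2)) :=
  exists wk : nat -> L2 * ('I_n.+1 -> L2),
    [/\ forall k, test_pair (wk k), (wk k).1 @[k --> \oo] --> w.1 &
        forall i, (wk k).2 i @[k --> \oo] --> w.2 i].

Definition H10_pred : {pred L2 * ('I_n.+1 -> L2)} := [pred w | `[< H10_spec w >]].


Let CkD k (a : R) (f g : V -> R) : Ck k f -> Ck k g -> Ck k (a *: f + g).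
Proof.
elim: k f g => [|k IH] f g /= [cf hf] [cg hg]; split => //.
- by move=> x; apply: continuousD; [apply: continuousZl_tmp; exact: cf|exact: cg].
- by move=> x; apply: continuousD; [apply: continuousZl_tmp; exact: cf|exact: cg].
- move=> i; have [df Cf] := hf i; have [dg Cg] := hg i; split.
    by move=> x; apply: derivableD; [apply: derivableZ; exact: df|exact: dg].
  rewrite (_ : partial i _ = a *: partial i f + partial i g); first exact: IH.
  apply/funext => x; rewrite /partial deriveD//; last exact: derivableZ.
  by rewrite deriveZ.
Qed.

Lemma test_functionD (a : R) (f g : V -> R) :
  test_function f -> test_function g -> test_function (a *: f + g).
Proof.
move=> [Cf cf sf] [Cg cg sg].
have sub : supp (a *: f + g) `<=` supp f `|` supp g.
  rewrite /supp -closureU; apply: closure_subset => x /= h.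
  have [fx|fx] := eqVneq (f x) 0; last by left.
  by right; apply: contraNneq h => gx; rewrite (_ : (a *: f + g) x = a * f x + g x)// fx gx mulr0 addr0.
split.
- by move=> k; exact: CkD.
- apply: (subclosed_compact _ _ sub); first exact: closed_closure.
  exact: compactU.
- by apply: subset_trans sub _; rewrite subUset.
Qed.

Lemma partial_lin i (a : R) (f g : V -> R) : test_function f -> test_function g ->
  partial i (a *: f + g) = a *: partial i f + partial i g.
Proof.
move=> [Cf _ _] [Cg _ _]; have [_ /(_ i)[df _]] := Cf 1%N.
have [_ /(_ i)[dg _]] := Cg 1%N.
apply/funext => x; rewrite /partial deriveD//; last exact: derivableZ.
by rewrite deriveZ.
Qed.

Lemma L2_ae_lin a (u v : L2) (f g : V -> R) : (u : V -> R) = f %[ae leb_on Om] ->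
  (v : V -> R) = g %[ae leb_on Om] ->
  (a *: u + v : V -> R) = a *: f + g %[ae leb_on Om].
Proof.
move=> uf vg; have h1 := Lspace_addE (a *: u) v; have h2 := Lspace_scaleE a u.
near=> x => _; rewrite (near h1 x)//= (near h2 x)// (near uf x)// (near vg x)//.
Unshelve. all: by end_near. Qed.

Let Ck0 k : Ck k (cst 0).
Proof.
have p0 i : partial i (cst 0) = cst 0.
  by apply/funext => x; rewrite /partial derive_cst.
elim: k => [|k IH] /=; first by split => // x; exact: cst_continuous.
split; first by move=> x; exact: cst_continuous.
by move=> i; rewrite p0.
Qed.

Lemma test_pair0 : test_pair 0.
Proof.
have s0 : supp (cst 0) = set0.
  rewrite /supp (_ : [set _ | _] = set0) ?closure0//.
  by apply/seteqP; split => x //=; rewrite eqxx.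
exists (cst 0); split.
- by split; [exact: Ck0|rewrite s0; exact: compact0|rewrite s0].
- exact: Lspace_0E.
- move=> i; rewrite (_ : partial i _ = cst 0); first exact: Lspace_0E.
  by apply/funext => x; rewrite /partial derive_cst.
Qed.

Lemma test_pairD a v w : test_pair v -> test_pair w -> test_pair (a *: v + w).
Proof.
move=> [f [tf f1 f2]] [g [tg g1 g2]]; exists (a *: f + g); split.
- exact: test_functionD.
- exact: L2_ae_lin.
- by move=> i; rewrite partial_lin//; exact: L2_ae_lin.
Qed.

Lemma H10_submod_closed : submod_closed H10_pred.
Proof.
split.
  apply/asboolP; exists (fun=> 0 : L2 * (_ -> L2)); split.
  - by move=> _; exact: test_pair0.
  - exact: cvg_cst.
  - by move=> i; exact: cvg_cst.
move=> a v w /asboolP[vk [tv v1 v2]] /asboolP[wk [tw w1 w2]].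
apply/asboolP; exists (fun k => a *: vk k + wk k); split.
- by move=> k; exact: test_pairD.
- have h : (a *: (vk k).1 + (wk k).1) @[k --> \oo] --> a *: v.1 + w.1.
    by apply: cvgD => //; exact: cvgZl_tmp.
  exact: h.
- move=> i.
  have h : (a *: (vk k).2 i + (wk k).2 i) @[k --> \oo] --> a *: v.2 i + w.2 i.
    by apply: cvgD; [apply: cvgZl_tmp; exact: v2|exact: w2].
  exact: h.
Qed.

HB.instance Definition _ := GRing.isSubmodClosed.Build R _ H10_pred H10_submod_closed.

Record H10 := MkH10 {
  H10_val :> L2 * ('I_n.+1 -> L2);
  H10P : H10_val \in H10_pred }.
HB.instance Definition _ := [isSub for H10_val].
HB.instance Definition _ := [Choice of H10 by <:].
HB.instance Definition _ := [SubChoice_isSubLmodule of H10 by <:].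


Definition H1norm (w : H10) : R :=
  Num.sqrt (`|(H10_val w).1| ^+ 2 + \sum_i `|(H10_val w).2 i| ^+ 2).

(* H^-1(Om): the bounded linear functionals on H^1_0(Om), with the dual norm. *)
Definition Hm1_spec (F : H10 -> R) :=
  scalar F /\ exists C, forall w, `|F w| <= C * H1norm w.

Definition Hm1_pred : {pred H10 -> R} := [pred F | `[< Hm1_spec F >]].

Lemma Hm1_submod_closed : submod_closed Hm1_pred.
Proof.
split.
  apply/asboolP; split; first by move=> a v w; rewrite /= mulr0 addr0.
  by exists 0 => w; rewrite normr0 mul0r.
move=> a F G /asboolP[lF [C hC]] /asboolP[lG [D hD]]; apply/asboolP; split.
  move=> b v w; rewrite [LHS](_ : _ = a * F (b *: v + w) + G (b *: v + w))//.
  rewrite [X in _ = _ * X + _](_ : _ = a * F v + G v)//.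
  rewrite [X in _ = _ + X](_ : _ = a * F w + G w)// lF lG /=; ring.
exists (`|a| * C + D) => w.
rewrite (_ : (a *: F + G) w = a * F w + G w)// mulrDl (le_trans (ler_normD _ _))//.
by rewrite lerD// normrM -mulrA ler_wpM2l.
Qed.

HB.instance Definition _ :=
  GRing.isSubmodClosed.Build R _ Hm1_pred Hm1_submod_closed.

Record Hm1 := MkHm1 {
  Hm1_val :> H10 -> R;
  Hm1P : Hm1_val \in Hm1_pred }.
HB.instance Definition _ := [isSub for Hm1_val].
HB.instance Definition _ := [Choice of Hm1 by <:].
HB.instance Definition _ := [SubChoice_isSubLmodule of Hm1 by <:].

Definition Hm1_norm (F : Hm1) : R := sup [set `|F w| | w in [set w | H1norm w <= 1]].

Lemma H1norm0 : H1norm 0 = 0.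
Proof.
rewrite /H1norm (_ : (H10_val 0) = 0)//= !normr0 expr0n /= add0r.
by rewrite big1 ?sqrtr0// => i _; rewrite normr0 expr0n.
Qed.

Lemma H1normZ a w : H1norm (a *: w) = `|a| * H1norm w.
Proof.
rewrite /H1norm (_ : (H10_val (a *: w)) = a *: H10_val w)//=.
rewrite normrZ exprMn (eq_bigr (fun i => `|a| ^+ 2 * `|(H10_val w).2 i| ^+ 2)); last first.
  by move=> i _; rewrite -exprMn -normrZ.
by rewrite -mulr_sumr -mulrDr sqrtrM ?exprn_ge0// sqrtr_sqr normr_id.
Qed.

Lemma H1norm_ge0 w : 0 <= H1norm w. Proof. exact: sqrtr_ge0. Qed.
#[local] Hint Resolve H1norm_ge0 : core.

Lemma Hm1_scalar (F : Hm1) : scalar F.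
Proof. by case: F => F /= /asboolP[]. Qed.

Lemma Hm1_0 (F : Hm1) : F 0 = 0.
Proof.
have := Hm1_scalar F 1 0 0; rewrite scaler0 addr0 mul1r => /eqP.
by rewrite -[X in X == _]addr0 (inj_eq (addrI _)) eq_sym => /eqP.
Qed.

Lemma Hm1_Z (F : Hm1) a w : F (a *: w) = a * F w.
Proof. by have := Hm1_scalar F a w 0; rewrite addr0 Hm1_0 addr0. Qed.

Lemma Hm1_has_sup (F : Hm1) :
  has_sup [set `|F w| | w in [set w | H1norm w <= 1]].
Proof.
split; first by exists `|F 0|, 0 => //=; rewrite H1norm0.
have /asboolP[_ [C hC]] := Hm1P F; exists `|C| => _ [w /= w1 <-].
rewrite (le_trans (hC w))// (le_trans (ler_norm _))// normrM.
by rewrite (ger0_norm (H1norm_ge0 w)) ler_piMr.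
Qed.

Lemma Hm1_norm_ub (F : Hm1) w : `|F w| <= Hm1_norm F * H1norm w.
Proof.
have [w0|w0] := eqVneq (H1norm w) 0.
  have /asboolP[_ [C /(_ w)]] := Hm1P F.
  by rewrite w0 !mulr0.
have wp : 0 < H1norm w by rewrite lt_neqAle eq_sym w0 H1norm_ge0.
rewrite -ler_pdivrMr//; have := ub_le_sup (proj2 (Hm1_has_sup F)).
move=> /(_ `|F ((H1norm w)^-1 *: w)|).
rewrite Hm1_Z normrM ger0_norm ?invr_ge0// mulrC; apply.
exists ((H1norm w)^-1 *: w) => /=; last by rewrite Hm1_Z normrM ger0_norm ?invr_ge0// mulrC.
by rewrite H1normZ ger0_norm ?invr_ge0// mulVf.
Qed.

Lemma Hm1_norm_le (F : Hm1) C :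
  (forall w, `|F w| <= C * H1norm w) -> 0 <= C -> Hm1_norm F <= C.
Proof.
move=> h C0; apply: ge_sup; first exact: (proj1 (Hm1_has_sup F)).
by move=> _ [w /= w1 <-]; rewrite (le_trans (h w))// ler_piMr.
Qed.

Let Hm1_norm_ge0 (F : Hm1) : 0 <= Hm1_norm F.
Proof.
apply: (@le_trans _ _ `|F 0|) => //.
by apply: ub_le_sup; [exact: (proj2 (Hm1_has_sup F))|exists 0; rewrite //= H1norm0].
Qed.

Let Hm1_normD (F G : Hm1) : Hm1_norm (F + G) <= Hm1_norm F + Hm1_norm G.
Proof.
apply: Hm1_norm_le => [w|]; last exact: addr_ge0.
rewrite (_ : (F + G : Hm1) w = F w + G w)// (le_trans (ler_normD _ _))//.
by rewrite mulrDl lerD// Hm1_norm_ub.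
Qed.

Let Hm1_normZ_le (a : R) (F : Hm1) : Hm1_norm (a *: F) <= `|a| * Hm1_norm F.
Proof.
apply: Hm1_norm_le => [w|]; last exact: mulr_ge0.
rewrite (_ : (a *: F : Hm1) w = a * F w)// normrM -mulrA.
by rewrite ler_wpM2l// Hm1_norm_ub.
Qed.

Let Hm1_normZ (a : R) (F : Hm1) : Hm1_norm (a *: F) = `|a| * Hm1_norm F.
Proof.
apply/eqP; rewrite eq_le Hm1_normZ_le /=.
have [->|a0] := eqVneq a 0; first by rewrite normr0 mul0r.
have ap : 0 < `|a| by rewrite normr_gt0.
rewrite mulrC -ler_pdivlMr// mulrC -normfV.
by have := Hm1_normZ_le a^-1 (a *: F); rewrite scalerA mulVf// scale1r.
Qed.

Let Hm1_norm0_eq0 (F : Hm1) : Hm1_norm F = 0 -> F = 0.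
Proof.
move=> F0; apply: val_inj; apply/funext => w /=.
have := Hm1_norm_ub F w; rewrite F0 mul0r => h.
by apply/eqP; rewrite -normr_eq0 eq_le h normr_ge0.
Qed.

HB.instance Definition _ :=
  Lmodule_isNormed.Build R Hm1 Hm1_normD Hm1_normZ Hm1_norm0_eq0.

End sobolev.

Section L2_pairing.
Context d (T : measurableType d) (R : realType).
Variable mu : {measure set T -> \bar R}.
Local Notation L2 := (LspaceType2 mu).

Definition L2_dot (u v : L2) : R := \int[mu]_x ((u x : R) * v x).

Lemma L2_dot_integrable (u v : L2) : mu.-integrable setT (EFin \o (fun x => u x * v x)).
Proof.
by apply/Lfun1_integrable; apply: Lfun2_mul_Lfun1; exact: (@Lspace_Lfun _ _ _ mu 2%:E (lee1n 2)).
Qed.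

#[local] Hint Resolve L2_dot_integrable : core.

Lemma L2_dot_linear (u : L2) : scalar (L2_dot u).
Proof.
move=> a v w; rewrite -RintegralZl// -RintegralD//; last first.
  rewrite (_ : _ \o _ = (fun x => a%:E * (u x * v x : R)%:E)%E)//.
  exact: (integrableZl measurableT a (L2_dot_integrable u v)).
congr fine; apply: ae_eq_integral => //.
- exact: (measurable_int mu (L2_dot_integrable u (a *: v + w))).
- apply/measurable_EFinP; apply: measurable_funD.
    apply: measurable_funM => //.
    by apply/measurable_EFinP; exact: (measurable_int mu (L2_dot_integrable u v)).
  by apply/measurable_EFinP; exact: (measurable_int mu (L2_dot_integrable u w)).
- have h1 := Lspace_addE (a *: v) w; have h2 := Lspace_scaleE a v.
  near=> x => _; congr EFin; rewrite (near h1 x)//= (near h2 x)//.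
  by rewrite mulrDr mulrCA.
Unshelve. all: by end_near. Qed.

Lemma L2_dot_le (u v : L2) : `|L2_dot u v| <= `|u| * `|v|.
Proof.
apply: le_trans (le_normr_Rintegral _ (L2_dot_integrable u v)) _ => //.
have fu := @Lebesgue_finite _ _ _ _ _ (lee1n 2) u.
have fv := @Lebesgue_finite _ _ _ _ _ (lee1n 2) v.
have fnu : ('N[mu]_2%:E[EFin \o u] \is a fin_num)%E by rewrite ge0_fin_numE ?Lnorm_ge0.
have fnv : ('N[mu]_2%:E[EFin \o v] \is a fin_num)%E by rewrite ge0_fin_numE ?Lnorm_ge0.
have mf (w : L2) : measurable_fun [set: T] (w : T -> R).
  by have /andP[/set_mem + _] := @Lspace_Lfun _ _ _ mu 2%:E (lee1n 2) w.
rewrite !LnormE /Rintegral -fineM//; apply: fine_le.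
- have /integrableP[_] := L2_dot_integrable u v.
  by rewrite ge0_fin_numE ?integral_ge0// => + //.
- by rewrite fin_numM.
have := @hoelder _ _ _ mu _ _ 2 2 (mf u) (mf v).
rewrite Lnorm1 => /(_ ltac:(by []) ltac:(by []) _); apply.
by rewrite [RHS]splitr !div1r.
Qed.

End L2_pairing.

Section game.
Context (R : realType) (n : nat) (Om : lipschitz_domain R n).
Local Notation V := 'rV[R]_n.+1.
Local Notation L2 := (L2 Om).

Let L2_Hm1_subproof (u : L2) :
  (fun w : H10 Om => L2_dot u (H10_val w).1) \in @Hm1_pred _ _ Om.
Proof.
apply/asboolP; split.
  by move=> a v w; exact: (L2_dot_linear u a (H10_val v).1 (H10_val w).1).
exists `|u| => w; apply: le_trans (L2_dot_le _ _) _.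
rewrite ler_wpM2l//; apply: (@le_trans _ _ (Num.sqrt (`|(H10_val w).1| ^+ 2))).
  by rewrite sqrtr_sqr normr_id.
by rewrite ler_wsqrtr// lerDl sumr_ge0// => i _; exact: exprn_ge0.
Qed.

(* The embedding of L^2 into H^-1: u acts on w in H^1_0 by the L^2 pairing. *)
Definition L2_Hm1 (u : L2) : Hm1 Om := MkHm1 (L2_Hm1_subproof u).

(* The class in L^2 of an element of L^q; meaningful when q >= 2, as Om is
   bounded. *)
Definition Lp_L2 (q : \bar R) (q1 : (1 <= q)%E) (v : Lp Om q1) : L2 :=
  Lclass (v : V -> R).

Lemma ge1_gt2 (q : R) : 2 < q -> (1 <= q%:E)%E.
Proof. by move=> q2; rewrite lee_fin ltW// (lt_trans _ q2)// ltr1n. Qed.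

Definition chi (D : set V) (v : L2) : L2 := Lclass (fun x => \1_D x * v x).

Definition pospart (v : L2) : L2 := Lclass (fun x => Num.max (v x) 0).

Definition L2norm_on (D : set V) (v : L2) : R :=
  Num.sqrt (\int[@leb R n]_(x in D) ((v x : R) ^+ 2)).

Definition opnorm (T : L2 -> L2) : R := sup [set `|T u| | u in [set u | `|u| <= 1]].

(* S_nu = A^-1 as an operator on L^2, through L^2 -> H^-1 -> Y -> L^q -> L^2. *)
Definition solop (q : \bar R) (q1 : (1 <= q)%E) (Y : Type) (emb : Y -> Lp Om q1)
  (Ainv : Hm1 Om -> Y) (u : L2) : L2 := Lp_L2 (emb (Ainv (L2_Hm1 u))).

Context (N : nat).
Local Notation U := {ffun 'I_N -> L2}.

Definition Uad_player (ua ub : L2) : set L2 :=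
  [set v | {ae leb_on Om, forall x, ua x <= v x <= ub x}].

Definition Uad (ua ub : U) : set U :=
  [set u | forall nu, Uad_player (ua nu) (ub nu) (u nu)].

Definition deviate (u : U) (nu : 'I_N) (v : L2) : U :=
  [ffun k => if k == nu then v else u k].

Definition fAL (S : L2 -> L2) (Omn : 'I_N -> set V) (yd : U) (psi : V -> R)
    (al : R) (nu : 'I_N) (u : U) (mu : L2) (rho : R) : R :=
  let Su := S (\sum_k u k) in
  2^-1 * L2norm_on (Omn nu) (Su - yd nu) ^+ 2 + al / 2 * `|u nu| ^+ 2
  + (2 * rho)^-1 * `|pospart (mu + rho *: (Su - Lclass psi))| ^+ 2.

Definition nash (J : 'I_N -> U -> R) (ua ub : U) (u : U) :=
  Uad ua ub u /\
  forall nu v, Uad_player (ua nu) (ub nu) v -> J nu u <= J nu (deviate u nu v).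

End game.

(* Main.v *)
From HB Require Import structures.
Require Import Defs.
From mathcomp Require Import all_boot all_order all_algebra.
From mathcomp Require Import all_classical all_reals all_analysis.
From mathcomp Require Import measurable_realfun ring lra.
Set Implicit Arguments.
Unset Strict Implicit.
Unset Printing Implicit Defensive.
Import Order.TTheory GRing.Theory Num.Theory.
Import numFieldNormedType.Exports.
Local Open Scope classical_set_scope.
Local Open Scope ring_scope.

(** The cost of each player is convex and differentiable in the player's own variable, so the
    equilibria are the solutions u in U_ad of one variational inequality
      (F u, v - u) >= 0 for all v in U_ad,
    in the Hilbert space of N-tuples of L^2 functions, where the component of F u for player nu is
      S* (chi_nu (S u - y_d^nu) + (mu + rho (S u - psi))_+) + alpha u^nu
    (fAL_expansion, nash_variational).

    The map F is Lipschitz, and the condition on alpha makes it strongly monotone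
    (gradient_monotone). Let w = u - v and h = S w. The penalty terms contribute
    ((mu + rho (S u - psi))_+ - (mu + rho (S v - psi))_+, h) >= 0. The tracking terms contribute
      sum_nu (chi_nu h, S_nu w^nu) = |chi_Z h|^2 - (chi_Z h, sum_nu B_nu w^nu)
                                  >= - |sum_nu B_nu w^nu|^2 / 4
                                  >= - (1/4) (sum_nu |B_nu|^2) |w|^2,
    where B_nu = chi_Z (S_nu - chi_nu S_nu). If all observation sets agree, then B_nu = 0 and the
    condition reads alpha > 0, so the second claim is a case of the first.

    On a nonempty closed convex set, a variational inequality with a Lipschitz and strongly
    monotone map has exactly one solution, by the contraction principle
    (variational_inequality). The projection used there and the adjoint S* both come from
    minimising a quadratic functional over a closed convex set (inner_variational). This needs
    L^2 to be complete (L2_complete) and S to be bounded on L^2, which holds because Om is bounded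
    and hence L^q embeds into L^2 (Lp_L2_bounded). *)

(** * Inequalities and limits over the reals *)

Section quadratic.
Context (R : realType).

(** Divide by t and let t tend to 0. Each first-order optimality condition below is
    obtained in this way from a comparison along a segment. *)
Lemma ge0_first_order (a b : R) :
  (forall t, 0 < t <= 1 -> 0 <= t * a + t ^+ 2 * b) -> 0 <= a.
Proof.
move=> h; rewrite leNgt; apply/negP => a0.
have bp : 0 < `|b| + 1 by rewrite ltr_pwDr.
pose t := Num.min 1 (- a / (2 * (`|b| + 1))).
have tgt0 : 0 < t by rewrite lt_min ltr01 divr_gt0 ?oppr_gt0// mulr_gt0.
have := h t; rewrite tgt0 ge_min lexx /= => /(_ isT).
have : t * (2 * (`|b| + 1)) <= - a.
  by rewrite -ler_pdivlMr ?mulr_gt0// ge_min lexx orbT.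
have bb : b <= `|b| by exact: ler_norm.
by move: bb bp tgt0 a0; move: t (`|b|) => t c; nra.
Qed.

(** Evaluate at the minimiser t = b / c. Both Cauchy-Schwarz inequalities below, for
    finite sums and for an inner product, are instances. *)
Lemma discriminant_le (a b c : R) :
  (forall t, 0 <= a - 2 * t * b + t ^+ 2 * c) -> 0 <= c -> b ^+ 2 <= a * c.
Proof.
move=> h c0; have [c0'|cN0] := eqVneq c 0.
  have [->|bN0] := eqVneq b 0; first by rewrite c0' mulr0 expr0n.
  have := h ((a + 1) / (2 * b)); rewrite c0' mulr0 addr0.
  rewrite (_ : 2 * _ * b = a + 1); last by field.
  by move=> ?; exfalso; lra.
have cp : 0 < c by rewrite lt_neqAle eq_sym cN0.
have := h (b / c); rewrite (_ : _ + _ = a - b ^+ 2 / c); last by field.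
by rewrite subr_ge0 ler_pdivrMr.
Qed.

Lemma sum_mul_sqr_le (I : finType) (a b : I -> R) :
  (\sum_i a i * b i) ^+ 2 <= (\sum_i a i ^+ 2) * (\sum_i b i ^+ 2).
Proof.
apply: discriminant_le => [t|]; last by apply: sumr_ge0 => i _; exact: sqr_ge0.
rewrite !mulr_sumr -sumrB -big_split /=; apply: sumr_ge0 => i _.
by rewrite (_ : _ + _ = (a i - t * b i) ^+ 2) ?sqr_ge0//; ring.
Qed.

Lemma convex_comb_itv (a b x y t : R) :
  a <= x <= b -> a <= y <= b -> 0 <= t <= 1 -> a <= x + t * (y - x) <= b.
Proof. by move=> /andP[? ?] /andP[? ?] /andP[? ?]; apply/andP; split; nra. Qed.

Lemma max0_sqr_le (x y : R) : x <= y -> Num.max x 0 ^+ 2 <= y ^+ 2.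
Proof.
move=> xy; case: (leP x 0) => x0; first by rewrite expr0n sqr_ge0.
by rewrite ler_sqr ?nnegrE// ?(le_trans _ xy)// ltW.
Qed.

Lemma pospart_sqr_itv (a b : R) :
  Num.max a 0 * (Num.max a 0 + 2 * b) <= Num.max (a + b) 0 * Num.max (a + b) 0 /\
  Num.max (a + b) 0 * Num.max (a + b) 0 <= (Num.max a 0 + b) * (Num.max a 0 + b).
Proof.
by case: (leP a 0) => ?; case: (leP (a + b) 0) => ?; split; nra.
Qed.

Lemma pospart_sub_bounds (a b : R) :
  0 <= (Num.max a 0 - Num.max b 0) * (a - b) /\
  (Num.max a 0 - Num.max b 0) ^+ 2 <= (a - b) ^+ 2.
Proof.
by have := sqr_ge0 (a - b); case: (leP a 0) => ?; case: (leP b 0) => ?; split; nra.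
Qed.

End quadratic.

Section limits.
Context (R : realType).

Lemma sqrt_cvg0 (x : nat -> R) : x @ \oo --> 0 -> Num.sqrt (x n) @[n --> \oo] --> 0.
Proof. by move=> /(cvg_comp _ _)/(_ (@sqrt_continuous R 0)); rewrite sqrtr0. Qed.

Lemma le0_cvg0 (c : R) (x : nat -> R) : x @ \oo --> 0 -> (forall n, c <= x n) -> c <= 0.
Proof.
move=> x0 cx; rewrite -(cvg_lim _ x0)//; apply: limr_ge; first exact/cvg_ex/(ex_intro _ 0).
exact: nearW.
Qed.

Lemma cvg0_natV (c : R) : c / n.+1%:R @[n --> \oo] --> 0.
Proof. by rewrite -(mulr0 c); apply: cvgM; [exact: cvg_cst|exact: cvg_harmonic]. Qed.

(** The increments of v are at most sqrt M / 2^j, hence summable. The weights 4^j keep the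
    hypothesis in terms of squares, which is what an L^2 bound controls. *)
Lemma cvgn_geometric_increments (v : nat -> R) (M : R) :
  (forall j, 4 ^+ j * (v j.+1 - v j) ^+ 2 <= M) -> cvgn v.
Proof.
move=> vM.
have M0 : 0 <= M by apply: le_trans (vM 0%N); rewrite mulr_ge0// sqr_ge0.
have sM j : `|v j.+1 - v j| <= Num.sqrt M * 2^-1 ^+ j.
  rewrite -sqrtr_sqr -[2^-1 ^+ j]ger0_norm// -sqrtr_sqr -sqrtrM//.
  rewrite ler_wsqrtr// -exprM mulnC exprM (_ : 2^-1 ^+ 2 = 4^-1); last first.
    by rewrite exprVn -natrX.
  by rewrite exprVn ler_pdivlMr ?exprn_gt0// mulrC.
have : cvgn (series (telescope v)).
  apply: normed_cvg; apply: (@series_le_cvg _ _ (geometric (Num.sqrt M) 2^-1)).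
  - by move=> n; exact: normr_ge0.
  - by move=> n; rewrite /geometric /= mulr_ge0// sqrtr_ge0.
  - exact: sM.
  - by apply: is_cvg_geometric_series; rewrite ger0_norm// invf_lt1// ltr1n.
move=> ct; rewrite (_ : v = (fun n => v 0%N + series (telescope v) n)).
  by apply: is_cvgD => //; exact: is_cvg_cst.
by apply/funext => n; exact: eq_sum_telescope.
Qed.

Lemma limn_einf_le (a b : nat -> \bar R) :
  (forall j, (a j <= b j)%E) -> (limn_einf a <= limn_einf b)%E.
Proof.
move=> ab; rewrite !limn_einf_lim; apply: lee_lim; [exact: is_cvg_einfs..|].
apply: nearW => n; apply: le_ereal_inf_tmp => _ [m /= nm <-].
by apply: le_trans (ab m); apply: ereal_inf_lbound; exists m.
Qed.

End limits.

(** * Variational inequalities in Hilbert space *)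

Section scalar_form.
Context (R : realType) (E : lmodType R) (l : E -> R).
Hypothesis linl : scalar l.

Lemma scalarD u v : l (u + v) = l u + l v.
Proof. by have := linl 1 u v; rewrite scale1r mul1r. Qed.

Lemma scalar0 : l 0 = 0.
Proof. by apply/eqP; rewrite -[_ == _](inj_eq (addrI (l 0))) -scalarD !addr0. Qed.

Lemma scalarZ a u : l (a *: u) = a * l u.
Proof. by have := linl a u 0; rewrite scalar0 !addr0. Qed.

Lemma scalarN u : l (- u) = - l u.
Proof. by rewrite -scaleN1r scalarZ mulN1r. Qed.

End scalar_form.

(** Completeness speaks of sequences whose squared distances are bounded by e m + e n with
    e tending to 0. Minimising sequences and fixed-point iterations come with such a bound, and
    it passes to u \o k whenever e \o k tends to 0, even if k is not increasing. *)
Record hilbert (R : realType) (E : lmodType R) (dot : E -> E -> R) : Prop :=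
  Hilbert {
    dotC : forall u v, dot u v = dot v u;
    dot_linear : forall u, scalar (dot u);
    dot_ge0 : forall u, 0 <= dot u u;
    dot_eq0 : forall u, dot u u = 0 -> u = 0;
    dot_complete : forall (u : nat -> E) (e : nat -> R), e @ \oo --> 0 ->
      (forall m n, dot (u m - u n) (u m - u n) <= e m + e n) ->
      exists l, dot (u n - l) (u n - l) @[n --> \oo] --> 0 }.

Section hilbert.
Context (R : realType) (E : lmodType R) (dot : E -> E -> R).
Hypothesis hE : hilbert dot.
Local Notation sq u := (dot u u).
Implicit Types (u v w : E) (C : set E).

Lemma dotDr u v w : dot u (v + w) = dot u v + dot u w.
Proof. exact: scalarD (dot_linear hE u) v w. Qed.

Lemma dot0r u : dot u 0 = 0.
Proof. exact: scalar0 (dot_linear hE u). Qed.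

Lemma dotZr a u v : dot u (a *: v) = a * dot u v.
Proof. exact: scalarZ (dot_linear hE u) a v. Qed.

Lemma dotNr u v : dot u (- v) = - dot u v.
Proof. exact: scalarN (dot_linear hE u) v. Qed.

Lemma dotBr u v w : dot u (v - w) = dot u v - dot u w.
Proof. by rewrite dotDr dotNr. Qed.

Lemma dotDl u v w : dot (u + v) w = dot u w + dot v w.
Proof. by rewrite dotC// dotDr !(dotC hE w). Qed.

Lemma dotZl a u v : dot (a *: u) v = a * dot u v.
Proof. by rewrite dotC// dotZr (dotC hE v). Qed.

Lemma dotNl u v : dot (- u) v = - dot u v.
Proof. by rewrite dotC// dotNr (dotC hE v). Qed.

Lemma dotBl u v w : dot (u - v) w = dot u w - dot v w.
Proof. by rewrite dotDl dotNl. Qed.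

Lemma dot_sum_r (I : Type) (r : seq I) (P : pred I) (f : I -> E) u :
  dot u (\sum_(i <- r | P i) f i) = \sum_(i <- r | P i) dot u (f i).
Proof. by apply: (big_morph (dot u)) => [v w|]; rewrite ?dotDr ?dot0r. Qed.

Let dotE := (dotDr, dotDl, dotNr, dotNl, dotZr, dotZl).

Lemma cauchy_schwarz u v : dot u v ^+ 2 <= sq u * sq v.
Proof.
apply: discriminant_le => [t|]; last exact: (dot_ge0 hE).
rewrite (_ : _ + _ = sq (u - t *: v)); first exact: (dot_ge0 hE).
by rewrite !dotE (dotC hE v u); ring.
Qed.

Lemma sqBC u v : sq (u - v) = sq (v - u).
Proof. by rewrite -opprB dotNl dotNr opprK. Qed.

Lemma sqD_le u v : sq (u + v) <= 2 * sq u + 2 * sq v.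
Proof.
have := dot_ge0 hE (u - v); rewrite !dotE (dotC hE v u) => ?; lra.
Qed.

Definition convex_set C := forall u v t, C u -> C v -> 0 <= t <= 1 -> C (u + t *: (v - u)).

Definition sq_closed C := forall (u : nat -> E) l, (forall n, C (u n)) ->
  sq (u n - l) @[n --> \oo] --> 0 -> C l.

(** Minimise J v = |v|^2 / 2 - l v over C. The parallelogram identity makes a minimising
    sequence Cauchy, and the claim is the first-order condition at its limit. For C = E this
    represents l by a vector; for l = (x, .) it is the characterisation of the projection of x
    onto C. *)
Theorem inner_variational C (l : E -> R) (M : R) : C !=set0 -> convex_set C -> sq_closed C ->
  scalar l -> 0 <= M -> (forall v, l v ^+ 2 <= M * sq v) ->
  exists2 u, C u & forall v, C v -> l (v - u) <= dot u (v - u).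
Proof.
move=> [c0 Cc0] convC closC linl M0 lM.
have lD := scalarD linl; have lZ := scalarZ linl; have lN := scalarN linl.
pose J v := sq v / 2 - l v.
have Jlb v : - (M / 2) <= J v.
  rewrite /J; have := lM v; have := dot_ge0 hE v.
  move: (sq v) (l v) => s r s0 rM; suff : r <= (M + s) / 2 by move=> ?; lra.
  have h : 0 <= (M + s) / 2 by lra.
  rewrite (le_trans (ler_norm r))// -(ger0_norm h) -ler_sqr ?nnegrE// !real_normK ?num_real//.
  by have := sqr_ge0 (M - s); lra.
have infJ : has_inf [set J v | v in C].
  split; first by exists (J c0), c0.
  by exists (- (M / 2)) => _ [v _ <-].
pose m := inf [set J v | v in C].
have mJ v : C v -> m <= J v by move=> Cv; apply: ge_inf; [exact: infJ.2|exists v].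
have /choice[u uP] : forall n : nat, exists v, C v /\ J v <= m + n.+1%:R^-1.
  move=> n; have n0 : 0 < n.+1%:R^-1 :> R by rewrite invr_gt0 ltr0n.
  have [_ [v Cv <-] vm] := inf_adherent n0 infJ.
  by exists v; split => //; exact: ltW.
clearbody m.
(* The parallelogram identity, with the midpoint of x and y as competitor. *)
have gap x y : C x -> C y -> sq (x - y) <= 4 * (J x - m) + 4 * (J y - m).
  move=> Cx Cy; have := mJ _ (convC x y (2^-1) Cx Cy _).
  rewrite /J !(dotE, lD, lN, lZ) (dotC hE y x) => /(_ ltac:(lra)).
  by move: (sq x) (sq y) (dot x y) (l x) (l y) => a b c d e; lra.
have [|q ql] := dot_complete hE (cvg0_natV 4) (u := u).
  move=> i j; apply: le_trans (gap _ _ (uP i).1 (uP j).1) _.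
  have := (uP i).2; have := (uP j).2.
  by move: (J _) (J _) i.+1%:R^-1 j.+1%:R^-1 => a b c d; lra.
have Cq : C q by apply: closC ql => n; exact: (uP n).1.
pose g v := dot q v - l v.
have Jq v : J (q + v) = J q + g v + sq v / 2.
  by rewrite /J /g !(dotE, lD) (dotC hE v q); lra.
have gB v : `|g v| <= Num.sqrt (2 * (sq q + M) * sq v).
  rewrite -sqrtr_sqr ler_wsqrtr// /g.
  have := cauchy_schwarz q v; have := lM v; have := sqr_ge0 (dot q v + l v).
  by move: (dot q v) (l v) (sq q) (sq v) => a b c d; lra.
(* J (u n) - J q = g (u n - q) + |u n - q|^2 / 2, where g is bounded. *)
have Jqm : J q <= m.
  have lim0 : 1 / n.+1%:R + Num.sqrt (2 * (sq q + M) * sq (u n - q)) @[n --> \oo] --> 0.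
    rewrite -(addr0 0); apply: cvgD; first exact: cvg0_natV.
    by apply: sqrt_cvg0; rewrite -(mulr0 (2 * (sq q + M))); apply: cvgM => //; exact: cvg_cst.
  have : (J q - m <= 0); last by rewrite subr_le0.
  apply: (le0_cvg0 lim0) => n.
  have := (uP n).2; have := Jq (u n - q); rewrite addrC subrK.
  have := gB (u n - q); have := ler_norm (- g (u n - q)); rewrite normrN.
  have := dot_ge0 hE (u n - q).
  move: n.+1%:R^-1 (J _) (sq (u n - q)) (g _) `|g _| (Num.sqrt _).
  by move: (J q) => a b c d e f h; lra.
exists q => // v Cv; rewrite -subr_ge0.
apply: (@ge0_first_order _ _ (sq (v - q) / 2)) => t /andP[/ltW t0 t1].
have := mJ _ (convC q v t Cq Cv ltac:(by rewrite t0 t1)).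
rewrite Jq /g (dotZr _ (t *: _)) dotZl lZ (dotZr t).
by move: Jqm; move: (dot q (v - q)) (l _) (sq (v - q)) (J q) => a b c d; lra.
Qed.

Corollary riesz (l : E -> R) (M : R) : scalar l -> 0 <= M ->
  (forall v, l v ^+ 2 <= M * sq v) -> exists u, forall v, l v = dot u v.
Proof.
move=> linl M0 lM.
have [|||u _ uP] := @inner_variational setT l M _ _ _ linl M0 lM => //.
  by exists 0.
have l1 v : l v <= dot u v by have := uP (u + v) I; rewrite addrAC subrr add0r.
exists u => v; apply/eqP; rewrite eq_le l1 /=.
by have := l1 (- v); rewrite scalarN// dotNr lerN2.
Qed.

Lemma projection C : C !=set0 -> convex_set C -> sq_closed C ->
  exists P : E -> E, (forall x, C (P x)) /\
    forall x v, C v -> dot (x - P x) (v - P x) <= 0.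
Proof.
move=> C0 convC closC.
suff /choice[P hP] : forall x, exists p, C p /\ forall v, C v -> dot (x - p) (v - p) <= 0.
  by exists P; split=> [x|x v Cv]; [exact: (hP x).1|exact: (hP x).2].
move=> x; have [|p Cp pP] := @inner_variational C (dot x) (sq x) C0 convC closC
  (dot_linear hE x) (dot_ge0 hE x).
  by move=> v; exact: cauchy_schwarz.
by exists p; split=> // v Cv; rewrite dotBl subr_le0; exact: pP.
Qed.

(** Write u_i - u_j as (T u_i - T u_j) + (residuals of u_i and u_j). The first part is absorbed
    in the left-hand side, so the distance of two iterates is controlled by their residuals,
    which decay like k^n. *)
Lemma contraction_fixpoint (T : E -> E) (k : R) : 0 < k < 1 ->
  (forall u v, sq (T u - T v) <= k * sq (u - v)) ->
  exists p, T p = p.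
Proof.
move=> /andP[k0 k1] Tk; pose d := sq (T 0 - 0); pose u n := iter n T 0.
have step n : sq (u n.+1 - u n) <= k ^+ n * d.
  elim: n => [|n IH]; first by rewrite expr0 mul1r.
  by apply: le_trans (Tk _ _) _; rewrite exprS -mulrA ler_wpM2l// ltW.
(* The weight in Young's inequality for which (1 + s) * k = (1 + k) / 2 < 1. *)
pose s := (1 - k) / (2 * k).
have s0 : 0 < s by rewrite divr_gt0 ?mulr_gt0// subr_gt0.
have young a b : sq (a + b) <= (1 + s) * sq a + (1 + s^-1) * sq b.
  have := dot_ge0 hE (s *: a - b); rewrite !dotE (dotC hE b a) => h.
  rewrite -subr_ge0 -(pmulr_rge0 _ s0) (_ : s * _ = s * (s * sq a) - 2 * s * dot a b + sq b).
    by move: h; move: (sq a) (dot a b) (sq b) => x y z; lra.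
  by field; rewrite gt_eqF.
pose c := 4 * (1 + s^-1) / (1 - k).
have kn0 : c * d * k ^+ n @[n --> \oo] --> 0.
  rewrite -(mulr0 (c * d)); apply: cvgM; first exact: cvg_cst.
  by apply: cvg_expr; rewrite ger0_norm ?ltW.
have [|p up] := dot_complete hE kn0 (u := u).
  move=> i j; have := Tk (u i) (u j).
  have := young (T (u i) - T (u j)) ((u i - T (u i)) + (T (u j) - u j)).
  rewrite (_ : _ + _ = u i - u j); last first.
    by rewrite addrACA (addrCA (T (u i))) subrr addr0 addKr.
  have := sqD_le (u i - T (u i)) (T (u j) - u j).
  have := step j; have := step i; rewrite (sqBC (u i)) -[T (u i)]/(u i.+1) -[T (u j)]/(u j.+1).
  have sk : (1 + s) * k = (1 + k) / 2 by rewrite /s; field; rewrite gt_eqF.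
  have r0 : 0 < 1 + s^-1 by rewrite addr_gt0// invr_gt0.
  rewrite (_ : c * d * _ + _ = 4 * (1 + s^-1) * (d * (k ^+ i + k ^+ j)) / (1 - k)); last first.
    by rewrite /c; ring.
  rewrite ler_pdivlMr ?subr_gt0//.
  move: (k ^+ i) (k ^+ j) (1 + s^-1) r0 => ki kj r r0.
  move: (sq (u i.+1 - u i)) (sq (u j.+1 - u j)) (sq (u i - u i.+1 + _)) (sq (u i - u j))
    (sq (u i.+1 - u j.+1)) => si sj z x y hi hj hz hx hy.
  have : (1 + s) * y <= (1 + s) * (k * x) by rewrite ler_wpM2l// addr_ge0// ltW.
  have : r * z <= r * (2 * (ki * d) + 2 * (kj * d)) by rewrite ler_wpM2l ?(ltW r0)//; lra.
  rewrite (mulrA _ k) sk; lra.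
exists p; apply/eqP; rewrite -subr_eq0; apply/eqP; apply: (dot_eq0 hE).
apply/eqP; rewrite eq_le (dot_ge0 hE) andbT.
have lim0 : 2 * sq (u n - p) + 2 * sq (u n.+1 - p) @[n --> \oo] --> 0.
  rewrite -(addr0 0) -(mulr0 2); apply: cvgD; apply: cvgM; try exact: cvg_cst.
    exact: up.
  by have := up; rewrite -(cvg_shiftS (fun n => sq (u n - p))).
apply: (le0_cvg0 lim0) => n.
have := sqD_le (T p - T (u n)) (T (u n) - p); rewrite addrA subrK.
have := Tk p (u n); rewrite (sqBC p (u n)).
have := dot_ge0 hE (u n - p); have -> : T (u n) = u n.+1 by [].
move: (sq (u n - p)) (sq (u n.+1 - p)) (sq (T p - u n.+1)) (sq (T p - p)) => x y z w.
by nra.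
Qed.

(** The Lions-Stampacchia theorem. The solutions are the fixed points of
    u |-> P (u - gamma F u), with P the projection onto C, for any gamma > 0. Since P does not
    increase distances, this map multiplies squared distances by at most
    1 - 2 gamma c + gamma^2 M, which is less than 1 for small gamma. *)
Theorem variational_inequality C (F : E -> E) (c M : R) :
  C !=set0 -> convex_set C -> sq_closed C -> 0 < c ->
  (forall u v, sq (F u - F v) <= M * sq (u - v)) ->
  (forall u v, c * sq (u - v) <= dot (F u - F v) (u - v)) ->
  exists! u, C u /\ forall v, C v -> 0 <= dot (F u) (v - u).
Proof.
move=> C0 convC closC c0 FM Fc.
have [P [CP PP]] := projection C0 convC closC.
have Pnexp x y : sq (P x - P y) <= sq (x - y).
  have h : sq (P x - P y) <= dot (x - y) (P x - P y).
    have := PP x (P y) (CP y); rewrite -(opprB (P x) (P y)) dotNr.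
    have -> : x - y = (x - P x) - (y - P y) + (P x - P y).
      by rewrite addrACA -opprD subrK subrK.
    by have := PP y (P x) (CP x); rewrite (dotDl (x - P x - _)) (dotBl (x - P x)); lra.
  move: h; move: (x - y) (P x - P y) => a b h.
  by have := dot_ge0 hE (a - b); rewrite dotBr !dotBl (dotC hE b a); lra.
(* For gamma = c / K with K >= M that factor is at most 1 - c^2 / K; K > c^2 keeps it
   positive. *)
pose K := `|M| + c ^+ 2 + 1.
have K0 : 0 < K by rewrite ltr_pwDr// addr_ge0// sqr_ge0.
pose T u := P (u - (c / K) *: F u).
have [||u Tu] := @contraction_fixpoint T (1 - c ^+ 2 / K).
- rewrite subr_gt0 ltrBlDr ltrDl divr_gt0 ?exprn_gt0// andbT ltr_pdivrMr// mul1r /K.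
  by have := normr_ge0 M; lra.
- move=> u v; apply: le_trans (Pnexp _ _) _.
  rewrite opprD addrACA -opprD -scalerBr.
  have := FM u v; have := Fc u v; have := dot_ge0 hE (u - v).
  move: (u - v) (F u - F v) => w f.
  rewrite dotBr !dotBl !(dotZr, dotZl) (dotC hE w f).
  move: (sq w) (dot f w) (sq f) => x y z x0 hy hz.
  have hy' : (c / K) * (c * x) <= (c / K) * y by rewrite ler_wpM2l// divr_ge0 ?ltW.
  have hz' : (c / K) ^+ 2 * z <= (c / K) ^+ 2 * (K * x).
    rewrite ler_wpM2l ?sqr_ge0// (le_trans hz)// ler_wpM2r// /K.
    by have := ler_norm M; have := sqr_ge0 c; lra.
  have e : (c / K) ^+ 2 * (K * x) = c ^+ 2 / K * x by field; rewrite gt_eqF.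
  move: hz'; rewrite e; move: hy'; rewrite (_ : c / K * (c * x) = c ^+ 2 / K * x); last by ring.
  by rewrite mulrA -expr2; move: (c / K) (c ^+ 2 / K) => p q; lra.
exists u; split.
  split; first by rewrite -Tu; exact: CP.
  move=> v Cv; have := PP (u - (c / K) *: F u) v Cv; rewrite -/(T u) Tu.
  rewrite addrAC subrr add0r dotNl oppr_le0 dotZl pmulr_rge0// divr_gt0//.
move=> v [Cv vP].
have Cu : C u by rewrite -Tu; exact: CP.
have uP : 0 <= dot (F u) (v - u).
  have := PP (u - (c / K) *: F u) v Cv; rewrite -/(T u) Tu.
  by rewrite addrAC subrr add0r dotNl oppr_le0 dotZl pmulr_rge0// divr_gt0.
apply/eqP; rewrite -subr_eq0; apply/eqP; apply: (dot_eq0 hE); apply/eqP.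
rewrite eq_le (dot_ge0 hE) andbT -(pmulr_rle0 _ c0).
apply: le_trans (Fc u v) _; rewrite dotBl subr_le0.
have := vP u Cu; rewrite -(opprB u v) in uP; move: uP; rewrite dotNr.
by move: (dot _ _) (dot _ _) => x y; lra.
Qed.

End hilbert.

(** * The Hilbert space L^2 *)

Section L2.
Context d (T : measurableType d) (R : realType).
Variable mu : {measure set T -> \bar R}.
Local Notation L2 := (LspaceType2 mu).

Lemma Lspace_measurable (u : L2) : measurable_fun [set: T] (u : T -> R).
Proof. by have /andP[/set_mem + _] := @Lspace_Lfun _ _ _ mu 2%:E (lee1n 2) u. Qed.
#[local] Hint Resolve Lspace_measurable : core.

Lemma measurable_sqrE (f : T -> R) : measurable_fun [set: T] f ->
  measurable_fun [set: T] (fun x => (f x ^+ 2)%:E).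
Proof. by move=> mf; apply/measurable_EFinP; exact: measurable_funX. Qed.

Lemma Lnorm2_sqr (f : T -> R) :
  ('N[mu]_2%:E[EFin \o f] `^ 2 = \int[mu]_x (f x ^+ 2)%:E)%E.
Proof.
rewrite poweR_Lnorm//; apply: eq_integral => x _.
by rewrite /= powR_mulrn// real_normK// num_real.
Qed.

Lemma integral_sqr (u : L2) : (\int[mu]_x ((u x : R) ^+ 2)%:E = (`|u| ^+ 2)%:E)%E.
Proof.
have fu := @Lebesgue_finite _ _ _ _ _ (lee1n 2) u.
have fnu : ('N[mu]_2%:E[EFin \o u] \is a fin_num)%E by rewrite ge0_fin_numE ?Lnorm_ge0.
rewrite -Lnorm2_sqr -(fineK fnu) poweR_EFin powR_mulrn ?LnormE//.
by rewrite fine_ge0// Lnorm_ge0.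
Qed.

Lemma L2_dotC (u v : L2) : L2_dot u v = L2_dot v u.
Proof. by congr fine; apply: eq_integral => x _; rewrite mulrC. Qed.

Lemma L2_dot_sqr (u : L2) : L2_dot u u = `|u| ^+ 2.
Proof.
rewrite /L2_dot /Rintegral -[RHS]/(fine (_%:E)) -integral_sqr.
by congr fine; apply: eq_integral => x _; rewrite expr2.
Qed.

Lemma Lfun2_sqr_lty (f : T -> R) : measurable_fun [set: T] f ->
  (\int[mu]_x (f x ^+ 2)%:E < +oo)%E -> f \in Lfun mu 2%:E.
Proof.
move=> mf fi; rewrite inE; apply/andP; split; rewrite inE//=.
by rewrite /finite_norm (@lty_poweRy _ _ 2)// Lnorm2_sqr.
Qed.

Lemma Lclass2E (f : T -> R) : measurable_fun [set: T] f ->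
  (\int[mu]_x (f x ^+ 2)%:E < +oo)%E -> ((Lclass f : L2) : T -> R) = f %[ae mu].
Proof. by move=> mf fi; apply: (LclassE (lee1n 2) (Lfun2_sqr_lty mf fi)); exact: ae_eq_refl. Qed.

Lemma Lspace_subE (u v : L2) : (u - v : T -> R) = (fun x => u x - v x) %[ae mu].
Proof.
have h1 := Lspace_addE u (- v); have := Lspace_scaleE (-1) v; rewrite scaleN1r => h2.
by apply: filterS2 h1 h2 => x /(_ I) -> /(_ I) /=; rewrite mulN1r => -> _.
Qed.

Lemma integral_sqr_le (f : T -> R) (v : L2) : measurable_fun [set: T] f ->
  {ae mu, forall x, f x ^+ 2 <= (v x : R) ^+ 2} ->
  (\int[mu]_x (f x ^+ 2)%:E <= (`|v| ^+ 2)%:E)%E.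
Proof.
move=> mf fv; rewrite -integral_sqr; apply: ae_ge0_le_integral => //.
- by move=> x _; rewrite lee_fin sqr_ge0.
- exact: measurable_sqrE.
- by move=> x _; rewrite lee_fin sqr_ge0.
- exact: measurable_sqrE.
- by apply: filterS fv => x h _; rewrite lee_fin.
Qed.

Lemma Lspace_norm_le (u v : L2) :
  {ae mu, forall x, (u x : R) ^+ 2 <= (v x : R) ^+ 2} -> `|u| <= `|v|.
Proof.
move=> uv; rewrite -ler_sqr ?nnegrE// -lee_fin -integral_sqr.
exact: integral_sqr_le.
Qed.

Lemma integral_sqr_sub (u v : L2) :
  (\int[mu]_x (((u x : R) - v x) ^+ 2)%:E = (`|u - v| ^+ 2)%:E)%E.
Proof.
rewrite -integral_sqr; apply: ge0_ae_eq_integral => //.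
- by apply: measurable_sqrE; apply: measurable_funB.
- exact: measurable_sqrE.
- by move=> x _; rewrite lee_fin sqr_ge0.
- by move=> x _; rewrite lee_fin sqr_ge0.
- by apply: filterS (Lspace_subE u v) => x /(_ I) -> _.
Qed.

Lemma L2_dot_ae_le (u v u' v' : L2) :
  {ae mu, forall x, (u x : R) * v x <= u' x * v' x} -> L2_dot u v <= L2_dot u' v'.
Proof.
move=> h; rewrite -subr_ge0 /L2_dot.
have i1 := L2_dot_integrable u v; have i2 := L2_dot_integrable u' v'.
rewrite -RintegralB//; have i3 := integrableB measurableT i2 i1.
have -> : \int[mu]_x ((u' x : R) * v' x - u x * v x) =
    \int[mu]_x (Num.max ((u' x : R) * v' x - u x * v x) 0).
  congr fine; apply: ae_eq_integral => //.
  - exact: (measurable_int mu i3).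
  - apply/measurable_EFinP; apply: measurable_maxr => //.
    by have /measurable_EFinP := measurable_int mu i3.
  - by apply: filterS h => x uv _; rewrite max_l// subr_ge0.
by apply: Rintegral_ge0 => x _; rewrite le_max lexx orbT.
Qed.

Lemma L2_dot_ae_eq (u v u' v' : L2) :
  {ae mu, forall x, (u x : R) * v x = u' x * v' x} -> L2_dot u v = L2_dot u' v'.
Proof.
by move=> h; apply/eqP; rewrite eq_le; apply/andP; split; apply: L2_dot_ae_le;
  apply: filterS h => x ->.
Qed.

End L2.

Section complete.
Context d (T : measurableType d) (R : realType).
Variable mu : {measure set T -> \bar R}.
Local Notation L2 := (LspaceType2 mu).

(** Riesz-Fischer. Choose v j = u (k j) with e (k j) <= 8^-j / 2. Then the function
    sum_j 4^j |v (j+1) - v j|^2 has integral at most 2, so it is finite almost everywhere and v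
    converges almost everywhere to some f. Fatou's lemma, applied to |u n - v j|^2 as j grows,
    bounds the integral of |u n - f|^2 by e n. *)
Theorem L2_complete (u : nat -> L2) (e : nat -> R) : e @ \oo --> 0 ->
  (forall m n, `|u m - u n| ^+ 2 <= e m + e n) ->
  exists l, `|u n - l| ^+ 2 @[n --> \oo] --> 0.
Proof.
move=> e0 ue.
have /choice[k ke] : forall j : nat, exists i, e i <= 8^-1 ^+ j / 2.
  move=> j; have : \forall i \near \oo, e i <= 8^-1 ^+ j / 2.
    by apply: (cvgr_le _ e0); rewrite divr_gt0// exprn_gt0.
  by move=> [i _ /(_ i (leqnn i))]; exists i.
pose v j := u (k j).
have mv j : measurable_fun [set: T] (v j : T -> R) by exact: Lspace_measurable.
pose h j x := (4 ^+ j * ((v j.+1 x : R) - v j x) ^+ 2)%:E.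
have h0 j x : (0 <= h j x)%E by rewrite lee_fin mulr_ge0// sqr_ge0.
have mh j : measurable_fun [set: T] (h j).
  apply/measurable_EFinP; apply: measurable_funM => //.
  by apply: measurable_funX; exact: measurable_funB.
have ih j : (\int[mu]_x h j x <= (2^-1 ^+ j)%:E)%E.
  rewrite /h; under eq_integral do rewrite EFinM.
  rewrite ge0_integralZl//; last 2 first.
  - by apply: measurable_sqrE; exact: measurable_funB.
  - by move=> x _; rewrite lee_fin sqr_ge0.
  rewrite integral_sqr_sub -EFinM lee_fin.
  have := ue (k j.+1) (k j); have := ke j; have := ke j.+1.
  rewrite exprS -/(v _) -/(v _).
  rewrite -(_ : 4 ^+ j * 8^-1 ^+ j = 2^-1 ^+ j); last first.
    by rewrite -exprMn (_ : 4 / 8 = 2^-1)//; field.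
  have : 0 <= 8^-1 ^+ j :> R by rewrite exprn_ge0.
  move: (8^-1 ^+ j) => r r0 h1 h2 h3; rewrite ler_wpM2l ?exprn_ge0//; lra.
have hfin : {ae mu, forall x, (\sum_(j <oo) h j x < +oo)%E}.
  suff H : mu.-integrable setT (fun x => \sum_(j <oo) h j x)%E.
    by apply: filterS (integrable_ae measurableT H) => x /(_ I); rewrite fin_numElt => /andP[].
  have mH : measurable_fun setT (fun x => \sum_(j <oo) h j x)%E.
    by apply: ge0_emeasurable_sum.
  apply/integrableP; split => //; under eq_integral do rewrite gee0_abs ?nneseries_ge0//.
  rewrite integral_nneseries//; apply: (@le_lt_trans _ _ 2%:E); last exact: ltry.
  apply: lime_le; first by apply: is_cvg_nneseries => n _ _; exact: integral_ge0.
  apply: nearW => n; apply: (@le_trans _ _ (\sum_(0 <= j < n) 2^-1 ^+ j)%:E).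
    by rewrite -sumEFin; apply: lee_sum.
  rewrite lee_fin (_ : \sum_(0 <= j < n) 2^-1 ^+ j = 2 - 2 * 2^-1 ^+ n :> R).
    by rewrite gerBl mulr_ge0// exprn_ge0.
  elim: n => [|n IH]; first by rewrite big_nil expr0; ring.
  by rewrite big_nat_recr//= IH exprS; field.
(* Any measurable function that is the limit where v converges; the upper limit is defined
   everywhere. *)
pose f x := fine (limn_esup (fun j => (v j x : R)%:E)).
have mf : measurable_fun [set: T] f.
  apply: measurableT_comp => //; apply: measurable_fun_limn_esup => // j.
  exact/measurable_EFinP.
have vf : {ae mu, forall x, (v j x : R) @[j --> \oo] --> f x}.
  apply: filterS hfin => x hx.
  have H0 : (0 <= \sum_(j <oo) h j x)%E by exact: nneseries_ge0.
  have /cvgn_geometric_increments/cvg_ex[y vy] : forall j, 4 ^+ j * ((v j.+1 x : R) - v j x) ^+ 2 <=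
      fine (\sum_(j <oo) h j x)%E.
    move=> j; rewrite -lee_fin fineK ?ge0_fin_numE//.
    apply: le_trans (nneseries_lim_ge j.+1 _) => //.
    by rewrite big_nat_recr//= leeDr// sume_ge0.
  suff -> : f x = y by [].
  rewrite /f; have /cvg_limn_einf_sup[_ ->] // : (v j x : R)%:E @[j --> \oo] --> y%:E.
  by apply: cvg_EFin; [exact: nearW|exact: vy].
have fatou_le n : (\int[mu]_x (((u n x : R) - f x) ^+ 2)%:E <= (e n)%:E)%E.
  have mun j : measurable_fun [set: T] (fun x => (((u n x : R) - v j x) ^+ 2)%:E).
    by apply: measurable_sqrE; apply: measurable_funB => //; exact: Lspace_measurable.
  have lim_sqr : {ae mu, forall x, limn_einf (fun j => (((u n x : R) - v j x) ^+ 2)%:E) =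
      (((u n x : R) - f x) ^+ 2)%:E}.
    apply: filterS vf => x vx.
    have /cvg_limn_einf_sup[-> _] // : (((u n x : R) - v j x) ^+ 2)%:E @[j --> \oo] -->
      (((u n x : R) - f x) ^+ 2)%:E.
    apply: cvg_EFin; first exact: nearW.
    by apply: cvgM; (apply: cvgB; [exact: cvg_cst|exact: vx]).
  rewrite (_ : (\int[mu]_x _)%E =
      (\int[mu]_x limn_einf (fun j => (((u n x : R) - v j x) ^+ 2)%:E))%E); last first.
    apply: ge0_ae_eq_integral => //.
    - by apply: measurable_sqrE; apply: measurable_funB => //; exact: Lspace_measurable.
    - rewrite /limn_einf; apply: measurableT_comp => //.
      by apply: measurable_fun_limn_esup => j; exact: measurableT_comp.
    - by move=> x _; rewrite lee_fin sqr_ge0.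
    - move=> x _; have [<- _] := cvg_limn_einf_sup (cvg_cst (0 : \bar R)).
      by apply: limn_einf_le => j; rewrite lee_fin sqr_ge0.
    - by apply: filterS lim_sqr => x ->.
  apply: le_trans (fatou _ _ mun _) _ => //; first by move=> j x _; rewrite lee_fin sqr_ge0.
  under eq_fun do rewrite integral_sqr_sub.
  apply: (@le_trans _ _ (limn_einf (fun j => (e n + 8^-1 ^+ j)%:E))).
    apply: limn_einf_le => j; rewrite lee_fin (le_trans (ue _ _))// lerD2l.
    by rewrite (le_trans (ke j))// ler_pdivrMr// ler_peMr ?exprn_ge0// ler1n.
  have /cvg_limn_einf_sup[-> _] // : (e n + 8^-1 ^+ j)%:E @[j --> \oo] --> (e n)%:E.
  apply: cvg_EFin; first exact: nearW.
  rewrite -[X in _ --> X]addr0; apply: cvgD; first exact: cvg_cst.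
  by apply: cvg_expr; rewrite ger0_norm// invf_lt1// ltr1n.
have mu0 n : measurable_fun [set: T] (fun x => (u n x : R) - f x).
  by apply: measurable_funB => //; exact: Lspace_measurable.
have gE := Lclass2E (mu0 0%N) (le_lt_trans (fatou_le 0%N) (ltry _)).
(* f belongs to L^2 because u 0 and u 0 - f do. *)
pose l : L2 := u 0%N - Lclass (fun x => (u 0%N x : R) - f x).
have lf : (l : T -> R) = f %[ae mu].
  have := Lspace_subE (u 0%N) (Lclass (fun x => (u 0%N x : R) - f x)).
  apply: filterS2 gE => x /(_ I) + /(_ I) + _.
  by rewrite -/l => -> ->; rewrite subKr.
exists l; apply: (@squeeze_cvgr _ _ _ _ (cst 0) e) => //; last exact: cvg_cst.
apply: nearW => n; rewrite sqr_ge0/= -lee_fin -integral_sqr_sub.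
apply: le_trans (fatou_le n); rewrite le_eqVlt; apply/orP; left; apply/eqP.
apply: ge0_ae_eq_integral => //.
- by apply: measurable_sqrE; apply: measurable_funB => //; exact: Lspace_measurable.
- exact: measurable_sqrE.
- by move=> x _; rewrite lee_fin sqr_ge0.
- by move=> x _; rewrite lee_fin sqr_ge0.
- by apply: filterS lf => x /(_ I) -> _.
Qed.

End complete.

Lemma hilbert_ffun (R : realType) (I : finType) (E : lmodType R) (dot : E -> E -> R) :
  hilbert dot -> hilbert (fun u v : {ffun I -> E} => \sum_i dot (u i) (v i)).
Proof.
move=> hE; split.
- by move=> u v; apply: eq_bigr => i _; exact: dotC.
- move=> u a v w; rewrite mulr_sumr -big_split /=; apply: eq_bigr => i _.
  by rewrite !ffunE; exact: dot_linear.
- by move=> u; apply: sumr_ge0 => i _; exact: dot_ge0.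
- move=> u /eqP; rewrite psumr_eq0 => [/allP u0|i _]; last exact: dot_ge0.
  apply/ffunP => i; rewrite ffunE; apply: (dot_eq0 hE).
  by apply/eqP; exact: (u0 i (mem_index_enum i)).
move=> u e e0 ue.
have /choice[l ul] : forall i, exists l, dot (u n i - l) (u n i - l) @[n --> \oo] --> 0.
  move=> i; apply: (dot_complete hE e0) => m n; apply: le_trans (ue m n).
  rewrite (bigD1 i)//= !ffunE lerDl; apply: sumr_ge0 => j _; exact: dot_ge0.
exists [ffun i => l i].
under eq_fun do under eq_bigr do rewrite !ffunE.
have := @cvg_big _ _ +%R 0 xpredT (@add_continuous R^o) _ \oo (index_enum I) _ _ _
  (fun i _ => ul i).
by rewrite big1 => [|//]; apply.
Qed.

Section L2_hilbert.
Context d (T : measurableType d) (R : realType).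
Variable mu : {measure set T -> \bar R}.
Local Notation L2 := (LspaceType2 mu).

Lemma hilbert_L2 : hilbert (@L2_dot _ _ _ mu).
Proof.
split.
- exact: L2_dotC.
- exact: L2_dot_linear.
- by move=> u; rewrite L2_dot_sqr sqr_ge0.
- by move=> u /eqP; rewrite L2_dot_sqr sqrf_eq0 normr_eq0 => /eqP.
- move=> u e e0 ue.
  have [|l ul] := @L2_complete _ _ _ mu u e e0.
    by move=> m n; rewrite -L2_dot_sqr.
  by exists l; under eq_fun do rewrite L2_dot_sqr.
Qed.

End L2_hilbert.

(** * Restriction and positive part *)

Section operators.
Context (R : realType) (n : nat) (Om : lipschitz_domain R n).
Local Notation V := 'rV[R]_n.+1.
Local Notation L2 := (L2 Om).
Local Notation dot := (@L2_dot _ _ _ (leb_on Om)).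

Let mL (u : L2) : measurable_fun [set: V] (u : V -> R).
Proof. exact: Lspace_measurable. Qed.
#[local] Hint Resolve mL : core.

Lemma Lclass_dominatedE (f : V -> R) (v : L2) : measurable_fun [set: V] f ->
  (forall x, f x ^+ 2 <= (v x : R) ^+ 2) ->
  ((Lclass f : L2) : V -> R) = f %[ae leb_on Om].
Proof.
move=> mf fv; apply: Lclass2E => //; apply: le_lt_trans (ltry (`|v| ^+ 2)).
by apply: integral_sqr_le => //; exact: nearW.
Qed.

Lemma chiE (D : set V) (v : L2) : measurable D ->
  (chi D v : V -> R) = (fun x => \1_D x * v x) %[ae leb_on Om].
Proof.
move=> mD; apply: (@Lclass_dominatedE _ v).
  by apply: measurable_funM => //; exact: measurable_indic.
by move=> x; rewrite indicE; case: (_ \in _); rewrite ?mul1r// mul0r expr0n sqr_ge0.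
Qed.

Lemma pospartE (v : L2) : (pospart v : V -> R) = (fun x => Num.max (v x) 0) %[ae leb_on Om].
Proof.
apply: (@Lclass_dominatedE _ v); first exact: measurable_maxr.
by move=> x; case: (leP (v x) 0) => _; rewrite ?expr0n ?sqr_ge0.
Qed.

Lemma chi_linear (D : set V) : measurable D -> linear (@chi _ _ Om D).
Proof.
move=> mD a u v; apply: Lspace_eqP.
have h1 := chiE (a *: u + v) mD; have h2 := L2_ae_lin a (chiE u mD) (chiE v mD).
have h3 := @L2_ae_lin _ _ _ a u v u v (ae_eq_refl _ _ _) (ae_eq_refl _ _ _).
near=> x => _; rewrite (near h1 x)// (near h2 x)// (near h3 x)//.
by rewrite mulrDr mulrCA.
Unshelve. all: by end_near. Qed.

Lemma chiD (D : set V) (u v : L2) : measurable D -> chi D (u + v) = chi D u + chi D v.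
Proof. by move=> mD; have := chi_linear mD 1 u v; rewrite !scale1r. Qed.

Lemma chiB (D : set V) (u v : L2) : measurable D -> chi D (u - v) = chi D u - chi D v.
Proof.
by move=> mD; have := chi_linear mD (-1) v u; rewrite !scaleN1r !(addrC (- _)).
Qed.

Lemma chiZ (D : set V) a (u : L2) : measurable D -> chi D (a *: u) = a *: chi D u.
Proof.
move=> mD; have chi0 : chi D (0 : L2) = 0 by have := chiB (0 : L2) 0 mD; rewrite !subrr.
by have := chi_linear mD a u 0; rewrite chi0 !addr0.
Qed.

Lemma chi_selfadjoint (D : set V) (u v : L2) : measurable D ->
  dot (chi D u) v = dot u (chi D v).
Proof.
move=> mD; apply: L2_dot_ae_eq.
by apply: filterS2 (chiE u mD) (chiE v mD) => x /(_ I) -> /(_ I) ->; ring.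
Qed.

Lemma chi_sub (D E : set V) (u : L2) : measurable D -> measurable E -> D `<=` E ->
  chi E (chi D u) = chi D u.
Proof.
move=> mD mE DE; apply: Lspace_eqP.
have h1 := chiE u mD; have h2 := chiE (chi D u) mE.
near=> x => _; rewrite (near h2 x)// (near h1 x)// !indicE.
case: (boolP (x \in D)) => [/set_mem /DE /mem_set -> |_]; rewrite ?mul1r//.
by rewrite mul0r mulr0.
Unshelve. all: by end_near. Qed.

Lemma chi_dot_chi (D : set V) (u v : L2) : measurable D ->
  dot (chi D u) (chi D v) = dot (chi D u) v.
Proof. by move=> mD; rewrite -(chi_selfadjoint _ v mD) (chi_sub u mD mD). Qed.

Lemma chi_norm (D : set V) (u : L2) : measurable D -> `|chi D u| <= `|u|.
Proof.
move=> mD; apply: Lspace_norm_le; apply: filterS (chiE u mD) => x /(_ I) ->.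
by rewrite indicE; case: (_ \in _); rewrite ?mul1r// mul0r expr0n sqr_ge0.
Qed.

Lemma L2norm_onE (D : set V) (u : L2) : measurable D -> D `<=` Om ->
  L2norm_on D u = `|chi D u|.
Proof.
move=> mD DO; rewrite /L2norm_on -[RHS]ger0_norm// -sqrtr_sqr; congr Num.sqrt.
rewrite -[RHS]/(fine (_%:E)) -integral_sqr; congr fine.
transitivity (\int[leb_on Om]_(x in D) ((u x : R) ^+ 2)%:E)%E.
  apply: eq_measure_integral => A mA AD.
  by rewrite -[RHS]/(leb (A `&` Om)) setIidl//; exact: subset_trans DO.
rewrite [LHS]integral_mkcond.
apply: ge0_ae_eq_integral.
- exact: measurableT.
- apply/(measurable_restrictT _ mD); apply: measurable_funTS; exact: measurable_sqrE.
- exact: measurable_sqrE.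
- by move=> x _; rewrite /patch; case: ifP => // _; rewrite lee_fin sqr_ge0.
- by move=> x _; rewrite lee_fin sqr_ge0.
apply: filterS (chiE u mD) => x /(_ I) -> _; rewrite /patch indicE.
by case: (_ \in _); rewrite ?mul1r// mul0r expr0n.
Qed.

(** The functional |u_+|^2 is convex, and its derivative 2 u_+ is Lipschitz with constant 2. *)
Lemma pospart_expansion (u h : L2) :
  0 <= `|pospart (u + h)| ^+ 2 - `|pospart u| ^+ 2 - 2 * dot (pospart u) h <= `|h| ^+ 2.
Proof.
have hL := hilbert_L2 (leb_on Om).
have h1 := Lspace_addE u h; have h2 := pospartE u; have h3 := pospartE (u + h).
rewrite -!L2_dot_sqr; apply/andP; split.
  suff : dot (pospart u) (pospart u + 2 *: h) <= dot (pospart (u + h)) (pospart (u + h)).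
    rewrite (dotDr hL) (dotZr hL).
    by move: (dot _ (pospart u)) (dot (pospart (u + h)) _) (dot _ h) => x y z; lra.
  apply: L2_dot_ae_le.
  have h4 := Lspace_addE (pospart u) (2 *: h); have h5 := Lspace_scaleE 2 h.
  near=> x; rewrite (near h4 x)//= (near h5 x)// (near h3 x)// (near h2 x)// (near h1 x)//=.
  by have [] := pospart_sqr_itv (u x) (h x).
suff : dot (pospart (u + h)) (pospart (u + h)) <= dot (pospart u + h) (pospart u + h).
  rewrite (dotDr hL (_ + h)) (dotDl hL (pospart u)) (dotDl hL (pospart u)).
  rewrite (dotC hL h (pospart u)).
  move: (dot (pospart u) (pospart u)) (dot (pospart (u + h)) _) (dot _ h) (dot h h).
  by move=> x y z t; lra.
apply: L2_dot_ae_le; have h4 := Lspace_addE (pospart u) h.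
near=> x; rewrite (near h4 x)//= (near h3 x)// (near h2 x)// (near h1 x)//=.
by have [] := pospart_sqr_itv (u x) (h x).
Unshelve. all: by end_near. Qed.

Lemma pospart_monotone (u v : L2) : 0 <= dot (pospart u - pospart v) (u - v).
Proof.
rewrite -(dot0r (hilbert_L2 _) (0 : L2)); apply: L2_dot_ae_le.
have h1 := Lspace_subE (pospart u) (pospart v); have h2 := Lspace_subE u v.
have h3 := pospartE u; have h4 := pospartE v; have h5 := @Lspace_0E _ _ _ (leb_on Om) _ (lee1n 2).
near=> x.
rewrite (near h5 x)// (near h1 x)// (near h2 x)// (near h3 x)// (near h4 x)// /cst /= mulr0.
by have [] := pospart_sub_bounds (u x) (v x).
Unshelve. all: by end_near. Qed.

Lemma pospart_lipschitz (u v : L2) : `|pospart u - pospart v| <= `|u - v|.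
Proof.
apply: Lspace_norm_le.
have h1 := Lspace_subE (pospart u) (pospart v); have h2 := Lspace_subE u v.
have h3 := pospartE u; have h4 := pospartE v.
near=> x; rewrite (near h1 x)// (near h2 x)// (near h3 x)// (near h4 x)//.
by have [] := pospart_sub_bounds (u x) (v x).
Unshelve. all: by end_near. Qed.

End operators.

(** * From L^q to L^2 on a bounded domain *)

Section embedding.
Context (R : realType) (n : nat) (Om : lipschitz_domain R n).
Local Notation V := 'rV[R]_n.+1.
Local Notation L2 := (L2 Om).

Lemma leb_on_finite : (leb_on Om [set: V] < +oo)%E.
Proof.
rewrite /leb_on /mrestr setTI.
have [M [Mreal bM]] := @lipdom_bounded _ _ Om.
pose m := `|M| + 1; have xm (x : V) : (Om : set V) x -> `|x| <= m.
  by apply: bM; rewrite /m (le_lt_trans (ler_norm M))// ltrDl.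
pose a : V := \row__ (- (m + 1)); pose b : V := \row__ (m + 1).
(* A cover of Om by one box; the remaining boxes are empty. *)
pose B (k : nat) : V * V := if k == 0%N then (a, b) else (0, 0).
apply: (@le_lt_trans _ _ (\sum_(k <oo) (box_vol (B k).1 (B k).2)%:E)%E).
  apply: ereal_inf_lbound; exists B => // x Ox; exists 0%N => //= i.
  rewrite !mxE; have : `|x 0 i| <= m.
    apply: le_trans (xm x Ox); rewrite [leRHS]mx_normrE.
    exact: (le_bigmax _ (fun ij : 'I_1 * 'I_n.+1 => `|x ij.1 ij.2|) (0, i)).
  by rewrite ler_norml => /andP[? ?]; apply/andP; split; lra.
rewrite (nneseries_split 0 1)//; last by move=> k _; rewrite lee_fin box_vol_ge0.
rewrite big_nat1 eseries0 ?adde0 ?ltry// => k k0 _; congr EFin.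
by rewrite /B gtn_eqF// /box_vol big_ord_recl subrr maxxx mul0r.
Qed.

Lemma Lp_L2E (q : R) (q2 : 2 < q) (v : Lp Om (ge1_gt2 q2)) :
  (Lp_L2 v : V -> R) = v %[ae leb_on Om].
Proof.
apply: (LclassE (lee1n 2)); last exact: ae_eq_refl.
apply: (Lfun_subset _ (ge1_gt2 q2)).
- exact: (lee1n 2).
- by rewrite ge0_fin_numE//; exact: leb_on_finite.
- by rewrite lee_fin ltW.
- exact: Lspace_Lfun.
Qed.

Lemma Lp_L2_linear (q : R) (q2 : 2 < q) : linear (@Lp_L2 _ _ Om _ (ge1_gt2 q2)).
Proof.
move=> a u v; apply: Lspace_eqP.
have h1 := Lp_L2E (a *: u + v); have h2 := L2_ae_lin a (Lp_L2E u) (Lp_L2E v).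
have h3 := Lspace_addE (a *: u) v; have h4 := Lspace_scaleE a u.
near=> x => _; rewrite (near h1 x)// (near h2 x)// (near h3 x)//= (near h4 x)//.
Unshelve. all: by end_near. Qed.

HB.instance Definition _ (q : R) (q2 : 2 < q) :=
  GRing.isLinear.Build R (Lp Om (ge1_gt2 q2)) L2 *:%R (@Lp_L2 _ _ Om _ (ge1_gt2 q2))
    (@Lp_L2_linear q q2).

(** Since v^2 <= 1 + |v|^q pointwise, the unit ball of L^q goes into the ball of squared radius
    |Om| + 1. *)
Lemma Lp_L2_bounded (q : R) (q2 : 2 < q) : exists2 C, 0 <= C &
  forall v : Lp Om (ge1_gt2 q2), `|Lp_L2 v| <= C * `|v|.
Proof.
have muf : leb_on Om [set: V] \is a fin_num by rewrite ge0_fin_numE// leb_on_finite.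
have q0 : 0 < q by exact: lt_trans q2.
pose K := fine (leb_on Om [set: V]) + 1.
have K0 : 0 <= K by rewrite addr_ge0// fine_ge0.
have unit_ball (v : Lp Om (ge1_gt2 q2)) : `|v| <= 1 -> `|Lp_L2 v| ^+ 2 <= K.
  move=> v1.
  have mv : measurable_fun [set: V] (v : V -> R).
    by have /andP[/set_mem + _] := Lspace_Lfun v.
  have mvq : measurable_fun [set: V] (fun x => (`|v x| `^ q)%:E).
    apply/measurable_EFinP; apply: (measurableT_comp (measurable_powR _)).
    exact: measurableT_comp.
  have ivq : (\int[leb_on Om]_x (`|v x| `^ q)%:E <= 1)%E.
    have fv := @Lebesgue_finite _ _ _ _ _ (ge1_gt2 q2) v.
    have fnv : ('N[leb_on Om]_q%:E[EFin \o v] \is a fin_num)%E.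
      by rewrite ge0_fin_numE ?Lnorm_ge0.
    have := powR_Lnorm (leb_on Om) (EFin \o v) (lt0r_neq0 q0).
    rewrite -(fineK fnv) poweR_EFin -LnormE /= => <-.
    by rewrite lee_fin (le_trans (ge0_ler_powR (ltW q0) _ _ v1)) ?nnegrE// powR1.
  rewrite -lee_fin -integral_sqr [leRHS]EFinD fineK//.
  apply: (@le_trans _ _ (\int[leb_on Om]_x (1 + (`|v x| `^ q)%:E))%E); last first.
    rewrite ge0_integralD//.
    by rewrite integral_cst// mul1e leeD2l.
  apply: ae_ge0_le_integral.
  - exact: measurableT.
  - by move=> x _; rewrite lee_fin sqr_ge0.
  - by apply: measurable_sqrE; exact: Lspace_measurable.
  - by move=> x _; rewrite -EFinD lee_fin addr_ge0// powR_ge0.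
  - exact: emeasurable_funD.
  apply: filterS (Lp_L2E v) => x /(_ I) -> _; rewrite -EFinD lee_fin.
  have [v1'|v1'] := leP `|v x| 1.
    by rewrite -real_normK ?num_real// -[leLHS]addr0 lerD ?powR_ge0// expr_le1.
  rewrite -real_normK ?num_real// -powR_mulrn// -[leLHS]add0r lerD//.
  by rewrite ler_powR// ltW.
exists (Num.sqrt K) => [|v]; first exact: sqrtr_ge0.
have [->|v0] := eqVneq v 0; first by rewrite linear0 !normr0 mulr0.
have vp : 0 < `|v| by rewrite normr_gt0.
have := unit_ball (`|v|^-1 *: v); rewrite linearZ !normrZ normfV normr_id mulVf ?gt_eqF//.
move=> /(_ (lexx _)) h; rewrite -ler_pdivrMr// mulrC -[leLHS]ger0_norm.
  by rewrite -sqrtr_sqr ler_wsqrtr.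
by rewrite mulr_ge0// invr_ge0.
Qed.

End embedding.

Lemma le_opnorm (R : realType) (n : nat) (Om : lipschitz_domain R n)
    (T : L2 Om -> L2 Om) (C : R) (u : L2 Om) :
  (forall a v, T (a *: v) = a *: T v) -> (forall v, `|T v| <= C * `|v|) ->
  `|T u| <= opnorm T * `|u|.
Proof.
move=> TZ TC; have [->|u0] := eqVneq u 0.
  by have := TZ 0 0; rewrite !scale0r => ->; rewrite !normr0 mulr0.
have up : 0 < `|u| by rewrite normr_gt0.
rewrite -ler_pdivrMr//; apply: ub_le_sup.
  exists `|C| => _ [v /= v1 <-]; apply: le_trans (TC v) _.
  by apply: le_trans (ler_norm _) _; rewrite normrM normr_id ler_piMr.
exists (`|u|^-1 *: u) => /=.
  by rewrite normrZ normfV normr_id mulVf ?gt_eqF.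
by rewrite TZ normrZ normfV normr_id mulrC.
Qed.

(** * The admissible sets *)

Section Uad.
Context (R : realType) (n : nat) (Om : lipschitz_domain R n).
Local Notation V := 'rV[R]_n.+1.
Local Notation L2 := (L2 Om).
Local Notation dot := (@L2_dot _ _ _ (leb_on Om)).

Lemma Uad_player_convex (ua ub : L2) : convex_set (Uad_player ua ub).
Proof.
move=> u v t Cu Cv /andP[t0 t1].
have h1 := Lspace_addE u (t *: (v - u)); have h2 := Lspace_scaleE t (v - u).
have h3 := Lspace_subE v u.
rewrite /Uad_player /=; near=> x.
rewrite (near h1 x)//= (near h2 x)// (near h3 x)//.
have /andP[] : (ua x : R) <= u x <= ub x by near: x.
have /andP[] : (ua x : R) <= v x <= ub x by near: x.
by move=> va vb ua' ub'; apply: convex_comb_itv; rewrite ?va ?vb ?ua' ?ub' ?t0.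
Unshelve. all: by end_near. Qed.

(** The upper bound says that (l - ub)_+ = 0. As v k <= ub, this function is dominated by
    |v k - l|, whose norm tends to 0. The lower bound is the same with ua - l. *)
Lemma Uad_player_closed (ua ub : L2) : sq_closed dot (Uad_player ua ub).
Proof.
move=> v l Cv vl.
have null (w : L2) : (forall k, `|pospart w| <= `|v k - l|) ->
    {ae leb_on Om, forall x, (w x : R) <= 0}.
  move=> wv; have pw0 : pospart w = 0.
    apply/eqP; rewrite -normr_eq0 -sqrf_eq0 eq_le sqr_ge0 andbT.
    by apply: (le0_cvg0 vl) => k; rewrite L2_dot_sqr ler_sqr ?nnegrE.
  have := pospartE w; rewrite pw0 => h1.
  apply: filterS2 h1 (@Lspace_0E _ _ _ (leb_on Om) _ (lee1n 2)) => x /(_ I) e1 /(_ I) e2.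
  have <- : Num.max (w x) 0 = 0 :> R by rewrite -e1 e2.
  by rewrite le_max lexx.
have hl : {ae leb_on Om, forall x, ((l - ub) x : R) <= 0}.
  apply: null => k; apply: Lspace_norm_le.
  have h1 := Lspace_subE l ub; have h2 := Lspace_subE (v k) l; have h3 := pospartE (l - ub).
  have h4 := Cv k.
  near=> x; rewrite (near h3 x)// (near h2 x)// (near h1 x)//.
  have /andP[] : (ua x : R) <= v k x <= ub x by near: x.
  by move=> _ cb; rewrite -(sqrrN (v k x - l x)) opprB max0_sqr_le// lerB.
have ha : {ae leb_on Om, forall x, ((ua - l) x : R) <= 0}.
  apply: null => k; apply: Lspace_norm_le.
  have h1 := Lspace_subE ua l; have h2 := Lspace_subE (v k) l; have h3 := pospartE (ua - l).
  have h4 := Cv k.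
  near=> x; rewrite (near h3 x)// (near h2 x)// (near h1 x)//.
  have /andP[] : (ua x : R) <= v k x <= ub x by near: x.
  by move=> ac _; rewrite max0_sqr_le// lerB.
have h1 := Lspace_subE l ub; have h2 := Lspace_subE ua l.
rewrite /Uad_player /=; near=> x.
rewrite -subr_le0 -(near h2 x)// -(subr_le0 (ub x)) -(near h1 x)//.
by apply/andP; split; near: x.
Unshelve. all: by end_near. Qed.

End Uad.

(** * The game as a variational inequality *)

Section game.
Context (R : realType) (n : nat) (Om : lipschitz_domain R n) (N : nat).
Local Notation V := 'rV[R]_n.+1.
Local Notation L2 := (L2 Om).
Local Notation dot := (@L2_dot _ _ _ (leb_on Om)).
Local Notation U := {ffun 'I_N -> L2}.
Let udot (u v : U) := \sum_k dot (u k) (v k).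

Let ffun_subE (u v : U) k : (u - v) k = u k - v k.
Proof. by rewrite !ffunE. Qed.

Lemma hilbert_U : hilbert udot.
Proof. exact/hilbert_ffun/hilbert_L2. Qed.

Lemma Uad_convex (ua ub : U) : convex_set (Uad ua ub).
Proof. by move=> u v t Cu Cv t01 k; rewrite !ffunE; exact: Uad_player_convex. Qed.

Lemma Uad_closed (ua ub : U) : sq_closed udot (Uad ua ub).
Proof.
move=> v l Cv vl k; apply: (Uad_player_closed (u := fun i => v i k)) => [i|]; first exact: Cv.
apply: (@squeeze_cvgr _ _ _ _ (cst 0) (fun i => udot (v i - l) (v i - l))) => //.
  apply: nearW => i; rewrite (dot_ge0 (hilbert_L2 _))//= /udot (bigD1 k)//= !ffunE lerDl.
  by apply: sumr_ge0 => j _; exact: (dot_ge0 (hilbert_L2 _)).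
exact: cvg_cst.
Qed.

Lemma sum_deviate (u : U) nu v : \sum_k deviate u nu v k = \sum_k u k + (v - u nu).
Proof.
rewrite (bigD1 nu)//= [in RHS](bigD1 nu)//= ffunE eqxx [RHS]addrC addrA subrK.
by congr (_ + _); apply: eq_bigr => k /negPf kn; rewrite ffunE kn.
Qed.

Context (S : {linear L2 -> L2}) (CS : R) (CS_ge0 : 0 <= CS).
Context (hS : forall v, `|S v| <= CS * `|v|).

Lemma adjoint : exists St : L2 -> L2, forall u v, dot (S u) v = dot u (St v).
Proof.
have hL := hilbert_L2 (leb_on Om).
suff /choice[St hSt] : forall v, exists w, forall u, dot v (S u) = dot w u.
  by exists St => u v; rewrite (dotC hL) hSt (dotC hL).
move=> v; apply: (@riesz _ _ _ hL (fun u => dot v (S u)) (`|v| ^+ 2 * CS ^+ 2)).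
- by move=> a u w; rewrite linearP (dotDr hL) (dotZr hL).
- by rewrite mulr_ge0 ?sqr_ge0.
- move=> u; apply: le_trans (cauchy_schwarz hL _ _) _; rewrite !L2_dot_sqr -(mulrA (`|v| ^+ 2)).
  by rewrite ler_wpM2l ?sqr_ge0// -exprMn ler_sqr ?nnegrE// (le_trans _ (hS u)).
Qed.

Context (Omn : 'I_N -> set V) (Omn_meas : forall nu, measurable (Omn nu)).
Context (Omn_sub : forall nu, Omn nu `<=` Om).
Context (yd : U) (psi : V -> R) (mu : L2).
Context (al rho : R) (al_gt0 : 0 < al) (rho_gt0 : 0 < rho).
Context (St : L2 -> L2) (hSt : forall u v, dot (S u) v = dot u (St v)).

(** Up to its positive part, the updated multiplier for the state constraint. *)
Definition penalty_arg (u : U) : L2 := mu + rho *: (S (\sum_k u k) - Lclass psi).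

(** The component nu represents the derivative of the cost of player nu in the player's own
    variable. As every player has a cost of their own, the map is in general not the derivative
    of a functional on U; hence a variational inequality rather than a minimisation. *)
Definition gradient (u : U) : U := [ffun nu =>
  St (chi (Omn nu) (S (\sum_k u k) - yd nu) + pospart (penalty_arg u)) + al *: u nu].

Let hL := hilbert_L2 (leb_on Om).
Let hU := hilbert_U.

Lemma dot_gradient (u : U) nu w : dot (gradient u nu) w =
  dot (chi (Omn nu) (S (\sum_k u k) - yd nu)) (S w) + dot (pospart (penalty_arg u)) (S w)
  + al * dot (u nu) w.
Proof. by rewrite ffunE !(dotDl hL) (dotZl hL) (dotC hL (St _)) -hSt (dotC hL) (dotDl hL). Qed.

Let dot_affine_sub (x x' p p' a a' y : L2) :
  dot (St (x + p) + al *: a - (St (x' + p') + al *: a')) y =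
  dot (x - x') (S y) + dot (p - p') (S y) + al * dot (a - a') y.
Proof.
have T z : dot (St z) y = dot z (S y) by rewrite (dotC hL) -hSt (dotC hL).
rewrite (dotBl hL (_ + _)) (dotDl hL (St (x + p))) (dotDl hL (St (x' + p'))).
rewrite (T (x + p)) (T (x' + p')) (dotDl hL x) (dotDl hL x') (dotZl hL al a) (dotZl hL al a').
by rewrite (dotBl hL x) (dotBl hL p) (dotBl hL a); ring.
Qed.

Lemma dot_gradientB u v nu y : dot ((gradient u - gradient v) nu) y =
  dot (chi (Omn nu) (S (\sum_k u k) - S (\sum_k v k))) (S y)
  + dot (pospart (penalty_arg u) - pospart (penalty_arg v)) (S y) + al * dot ((u - v) nu) y.
Proof.
rewrite ffun_subE (ffunE _ nu) (ffunE _ nu) dot_affine_sub -(chiB _ _ (Omn_meas nu)).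
by rewrite (opprB (S (\sum_k v k))) addrA subrK ffun_subE.
Qed.

(** Each of the three terms of the cost, composed with an affine map of v, is convex and
    differentiable with Lipschitz derivative. *)
Lemma fAL_expansion (u : U) nu v :
  0 <= fAL S Omn yd psi al nu (deviate u nu v) mu rho - fAL S Omn yd psi al nu u mu rho
       - dot (gradient u nu) (v - u nu)
    <= (CS ^+ 2 * (1 + rho) + al) / 2 * `|v - u nu| ^+ 2.
Proof.
rewrite dot_gradient /fAL sum_deviate.
have -> : deviate u nu v nu = u nu + (v - u nu) by rewrite ffunE eqxx subrKC.
move: (v - u nu) => w.
rewrite (linearD S) !L2norm_onE//.
rewrite (_ : S _ + S w - yd nu = (S (\sum_k u k) - yd nu) + S w); last first.
  by rewrite addrAC.
rewrite (_ : mu + rho *: (S (\sum_k u k) + S w - Lclass psi) =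
  penalty_arg u + rho *: S w); last first.
  by rewrite /penalty_arg addrAC scalerDr addrA.
rewrite -/(penalty_arg u) (chiD _ (S w) (Omn_meas nu)).
set a := chi (Omn nu) (S (\sum_k u k) - yd nu).
have aE : dot a (chi (Omn nu) (S w)) = dot a (S w) by exact: chi_dot_chi.
have /andP[] := pospart_expansion (penalty_arg u) (rho *: S w).
rewrite (dotZr hL) normrZ exprMn real_normK ?num_real//.
have chiw : `|chi (Omn nu) (S w)| ^+ 2 <= `|S w| ^+ 2 by rewrite ler_sqr ?nnegrE// chi_norm.
have Sw : `|S w| ^+ 2 <= CS ^+ 2 * `|w| ^+ 2.
  by rewrite -exprMn ler_sqr ?nnegrE// (le_trans _ (hS w)).
rewrite -(L2_dot_sqr (a + _)) -(L2_dot_sqr (u nu + _)) !(dotDl hL) !(dotDr hL) !L2_dot_sqr.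
rewrite (dotC hL (chi _ (S w)) a) aE (dotC hL w (u nu)).
move: (`|pospart (penalty_arg u + rho *: S w)| ^+ 2) (`|pospart (penalty_arg u)| ^+ 2) => P1 P0.
move: (dot (pospart (penalty_arg u)) (S w)) (dot a (S w)) (dot (u nu) w) => p b c.
move: (`|a| ^+ 2) (`|u nu| ^+ 2) => a2 u2; have := sqr_ge0 `|w|.
have := sqr_ge0 `|chi (Omn nu) (S w)|; move: chiw Sw.
move: (`|chi (Omn nu) (S w)| ^+ 2) (`|S w| ^+ 2) (`|w| ^+ 2) (CS ^+ 2) => x s w2 C.
move=> xs sw x0 w0 X0 Xs.
set m := (X in 0 <= X <= _).
have -> : m = x / 2 + al / 2 * w2 + (P1 - P0 - 2 * (rho * p)) / (2 * rho).
  by rewrite /m; field; rewrite gt_eqF.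
have : 0 <= al / 2 * w2 by rewrite mulr_ge0// divr_ge0// ltW.
have : 0 <= (P1 - P0 - 2 * (rho * p)) / (2 * rho) by rewrite divr_ge0// mulr_ge0// ltW.
have : (P1 - P0 - 2 * (rho * p)) / (2 * rho) <= rho * s / 2.
  by rewrite ler_pdivrMr ?mulr_gt0//; apply: le_trans Xs _; lra.
have : rho * s <= rho * (C * w2) by rewrite ler_wpM2l// ltW.
move: (_ / (2 * rho)) => y h1 h2 h3 h4; apply/andP; split; lra.
Qed.

(** Convexity of each cost in the player's own variable makes the first-order condition
    sufficient. As the admissible set is a product, the conditions of all players add up to one
    inequality, and conversely it suffices to vary one component at a time. *)
Lemma nash_variational (ua ub u : U) :
  nash (fun nu u => fAL S Omn yd psi al nu u mu rho) ua ub u <->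
  Uad ua ub u /\ forall v, Uad ua ub v -> 0 <= udot (gradient u) (v - u).
Proof.
split=> -[Cu h]; split=> //.
  move=> v Cv; apply: sumr_ge0 => nu _; rewrite !ffunE.
  apply: (@ge0_first_order _ _
    ((CS ^+ 2 * (1 + rho) + al) / 2 * `|v nu - u nu| ^+ 2)) => t /andP[t0 t1].
  have := h nu (u nu + t *: (v nu - u nu)).
  have /andP[_] := fAL_expansion u nu (u nu + t *: (v nu - u nu)).
  have -> : u nu + t *: (v nu - u nu) - u nu = t *: (v nu - u nu) by rewrite addrC addKr.
  rewrite (dotZr hL) normrZ exprMn real_normK ?num_real//.
  have Ct : Uad_player (ua nu) (ub nu) (u nu + t *: (v nu - u nu)).
    by apply: (Uad_player_convex (Cu nu) (Cv nu)); rewrite (ltW t0) t1.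
  move=> h1 /(_ Ct) h2.
  rewrite mulrCA; move: h1 h2; rewrite ffunE.
  move: (fAL _ _ _ _ _ _ (deviate _ _ _) _ _) (fAL _ _ _ _ _ _ u _ _) => x y.
  by move: (t * dot _ _) (_ / 2 * _) => p r; lra.
move=> nu v Cv; have /h : Uad ua ub (deviate u nu v).
  by move=> k; rewrite ffunE; case: eqP => [->|_]; [exact: Cv|exact: Cu].
rewrite /udot (bigD1 nu)//= big1 => [|k /negPf kn]; last first.
  by rewrite !ffunE kn subrr (dot0r hL).
rewrite addr0 !ffunE eqxx.
have /andP[+ _] := fAL_expansion u nu v; rewrite ffunE.
move: (fAL _ _ _ _ _ _ (deviate _ _ _) _ _) (fAL _ _ _ _ _ _ u _ _) => x y.
by move: (dot _ _) => p; lra.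
Qed.

Lemma adjoint_lipschitz x y : `|St x - St y| <= CS * `|x - y|.
Proof.
have [->|d0] := eqVneq (St x - St y) 0; first by rewrite normr0 mulr_ge0.
have dp : 0 < `|St x - St y| by rewrite normr_gt0.
rewrite -(ler_pM2l dp) -expr2 -L2_dot_sqr (dotBr hL) -!hSt -(dotBr hL).
apply: le_trans (ler_norm _) _; apply: le_trans (L2_dot_le _ _) _.
by rewrite mulrA ler_wpM2r// mulrC.
Qed.

Lemma penalty_argB u v : penalty_arg u - penalty_arg v = rho *: (S (\sum_k u k) - S (\sum_k v k)).
Proof.
rewrite /penalty_arg opprD addrACA subrr add0r -scalerBr; congr (_ *: _).
by rewrite opprB addrA subrK.
Qed.

Lemma S_sumB (u v : U) : S (\sum_k u k) - S (\sum_k v k) = S (\sum_k (u - v) k).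
Proof.
by rewrite -linearB -sumrB; congr (S _); apply: eq_bigr => k _; rewrite !ffunE.
Qed.

Lemma gradient_lipschitz : exists M, forall u v : U,
  udot (gradient u - gradient v) (gradient u - gradient v) <= M * udot (u - v) (u - v).
Proof.
pose L := CS ^+ 2 * (1 + rho) + al.
have L0 : 0 <= L by rewrite addr_ge0 ?(ltW al_gt0)// mulr_ge0 ?sqr_ge0// addr_ge0// ltW.
exists (N%:R * (L ^+ 2 * N%:R)) => u v.
pose s := \sum_k `|(u - v) k|.
have s0 : 0 <= s by exact: sumr_ge0.
have comp nu : `|(gradient u - gradient v) nu| <= L * s.
  pose z := S (\sum_k u k) - S (\sum_k v k).
  have zs : `|z| <= CS * s.
    rewrite /z S_sumB; apply: le_trans (hS _) _; rewrite ler_wpM2l//; exact: ler_norm_sum.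
  have us : `|u nu - v nu| <= s.
    by rewrite /s (bigD1 nu)//= !ffunE lerDl sumr_ge0.
  rewrite !ffunE opprD addrACA -scalerBr; apply: le_trans (ler_normD _ _) _.
  rewrite normrZ (gtr0_norm al_gt0) mulrDl lerD ?ler_wpM2l ?(ltW al_gt0)//.
  apply: le_trans (adjoint_lipschitz _ _) _.
  rewrite expr2 -!mulrA ler_wpM2l// opprD addrACA -chiB//.
  apply: le_trans (ler_normD _ _) _.
  have -> : S (\sum_k u k) - yd nu - (S (\sum_k v k) - yd nu) = z.
    by rewrite opprB addrA subrK.
  have h1 := chi_norm z (Omn_meas nu).
  have := pospart_lipschitz (penalty_arg u) (penalty_arg v).
  rewrite penalty_argB normrZ (gtr0_norm rho_gt0) -/z => h2.
  have h3 : rho * `|z| <= rho * (CS * s) by rewrite ler_wpM2l// ltW.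
  by move: h1 h2 h3 zs; move: `|z| => a; lra.
rewrite {1}/udot; apply: (@le_trans _ _ (\sum_(k < N) (L * s) ^+ 2)).
  by apply: ler_sum => k _; rewrite L2_dot_sqr ler_sqr ?nnegrE// mulr_ge0.
rewrite sumr_const card_ord -(mulr_natl (_ ^+ 2)) -(mulrA N%:R) ler_wpM2l//.
rewrite exprMn -(mulrA (L ^+ 2)) ler_wpM2l ?sqr_ge0//.
have := sum_mul_sqr_le (fun=> 1) (fun k : 'I_N => `|(u - v) k|).
under eq_bigr do rewrite mul1r; rewrite expr1n sumr_const card_ord => h.
by apply: le_trans h _; rewrite ler_wpM2l//; apply: ler_sum => k _; rewrite L2_dot_sqr.
Qed.

Let Z := \bigcup_(nu in [set: 'I_N]) Omn nu.
(** The part of the state of player nu that the other players observe and player nu does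
    not. *)
Let B nu v := chi Z (S v - chi (Omn nu) (S v)).

Let mZ : measurable Z.
Proof. by apply: fin_bigcup_measurable => //; exact: finite_finset. Qed.

Let OmnZ nu : Omn nu `<=` Z.
Proof. by move=> x xnu; exists nu. Qed.

Lemma le_opnorm_coupling nu v : `|B nu v| <= opnorm (B nu) * `|v|.
Proof.
apply: (@le_opnorm _ _ _ (B nu) (2 * CS)) => [a w|w].
  by rewrite /B linearZ chiZ// -scalerBr chiZ.
rewrite /B; apply: le_trans (chi_norm _ mZ) _; apply: le_trans (ler_normB _ _) _.
by have := chi_norm (S w) (Omn_meas nu); have := hS w; lra.
Qed.

(** On Omn nu the restrictions to Omn nu and to Z agree; B nu collects the rest of Z. *)
Lemma chi_dot_coupling nu h w : dot (chi (Omn nu) h) (S w) =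
  dot (chi Z h) (S w) - dot (chi Z h) (B nu w).
Proof.
rewrite /B -(chi_selfadjoint (chi Z h))// chi_sub// (dotBr hL) subKr.
by rewrite [RHS]chi_selfadjoint// chi_sub// chi_selfadjoint.
Qed.

(** With w = u - v, h = S (sum_k w k) and g = chi Z h, the tracking terms contribute
    |g|^2 - (g, sum_k B k (w k)) >= - |sum_k B k (w k)|^2 / 4, by completing the square, and
    Cauchy-Schwarz over the players bounds this by the operator norms. The penalty terms of all
    players add up to ((pos. part at u) - (pos. part at v), h), which is nonnegative because the
    players share the same penalty. *)
Lemma gradient_monotone u v :
  (al - 4^-1 * \sum_nu opnorm (B nu) ^+ 2) * udot (u - v) (u - v) <=
  udot (gradient u - gradient v) (u - v).
Proof.
pose h := S (\sum_k u k) - S (\sum_k v k); pose g := chi Z h.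
pose P := pospart (penalty_arg u) - pospart (penalty_arg v).
pose w := u - v; pose b := \sum_k B k (w k).
have hw : h = \sum_k S (w k) by rewrite /h S_sumB linear_sum.
have -> : udot (gradient u - gradient v) w = dot g h - dot g b + dot P h + al * udot w w.
  rewrite /udot hw /b !(dot_sum_r hL) mulr_sumr -sumrB -!big_split /=.
  by apply: eq_bigr => nu _; rewrite dot_gradientB (chi_dot_coupling nu h).
have Ph : 0 <= dot P h.
  have := pospart_monotone (penalty_arg u) (penalty_arg v).
  by rewrite penalty_argB (dotZr hL) -/h -/P pmulr_rge0.
have gh : dot g h = dot g g by exact/esym/chi_dot_chi.
have gb : - (4^-1 * dot b b) <= dot g h - dot g b.
  have := dot_ge0 hL (g - 2^-1 *: b); rewrite gh.
  rewrite (dotBr hL) !(dotBl hL) !(dotZr hL) !(dotZl hL) (dotC hL b g).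
  by move: (dot g g) (dot g b) (dot b b) => p q r; lra.
have bw : dot b b <= (\sum_nu opnorm (B nu) ^+ 2) * udot w w.
  rewrite L2_dot_sqr; apply: (@le_trans _ _ ((\sum_nu opnorm (B nu) * `|w nu|) ^+ 2)).
    have bs : `|b| <= \sum_nu opnorm (B nu) * `|w nu|.
      apply: le_trans (ler_norm_sum _ _ _) _; apply: ler_sum => nu _; exact: le_opnorm_coupling.
    by rewrite ler_sqr ?nnegrE// (le_trans _ bs).
  apply: le_trans (sum_mul_sqr_le _ _) _; rewrite le_eqVlt; apply/orP; left; apply/eqP.
  by congr (_ * _); apply: eq_bigr => k _; rewrite L2_dot_sqr.
rewrite -/w; move: bw gb Ph; move: (dot b b) (dot g h - dot g b) (dot P h) (udot w w).
by move: (\sum_nu _) => a x y z t; rewrite mulrBl -mulrA; lra.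
Qed.

Theorem nash_exists_unique (ua ub : U) :
  (forall nu, {ae leb_on Om, forall x, (ua nu x : R) <= ub nu x}) ->
  4^-1 * \sum_nu opnorm (B nu) ^+ 2 < al ->
  exists! u, nash (fun nu u => fAL S Omn yd psi al nu u mu rho) ua ub u.
Proof.
move=> uab small.
have [M FM] := gradient_lipschitz.
have [||u [uVI uniq]] := variational_inequality hU _ (@Uad_convex ua ub) (@Uad_closed ua ub)
  _ FM gradient_monotone.
- by exists ua => nu; apply: filterS (uab nu) => x; rewrite lexx.
- by rewrite subr_gt0.
exists u; split; first exact/nash_variational.
by move=> v /nash_variational; exact: uniq.
Qed.

End game.

(** * The solution operator *)

Lemma continuous_linear_bound (R : realType) (V W : normedModType R) (f : {linear V -> W}) :
  continuous f -> exists2 C, 0 <= C & forall v, `|f v| <= C * `|v|.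
Proof.
move=> /linear_bounded_continuous/linear_boundedP[C [_ fC]].
exists (`|C| + 1) => [|v]; first by rewrite addr_ge0.
by apply: fC; rewrite (le_lt_trans (ler_norm C))// ltrDl.
Qed.

Section solution_operator.
Context (R : realType) (n : nat) (Om : lipschitz_domain R n).
Local Notation L2 := (L2 Om).

Lemma L2_Hm1_linear : linear (@L2_Hm1 _ _ Om).
Proof.
move=> a u v; apply: val_inj; apply/funext => w /=.
by rewrite L2_dotC L2_dot_linear !(L2_dotC (H10_val w).1).
Qed.

HB.instance Definition _ := GRing.isLinear.Build R L2 (Hm1 Om) *:%R (@L2_Hm1 _ _ Om)
  L2_Hm1_linear.

Lemma L2_Hm1_norm (u : L2) : `|L2_Hm1 u| <= `|u|.
Proof.
apply: Hm1_norm_le => // w; apply: le_trans (L2_dot_le _ _) _.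
rewrite ler_wpM2l// -[leLHS]normr_id -sqrtr_sqr ler_wsqrtr// lerDl.
by apply: sumr_ge0 => i _; exact: sqr_ge0.
Qed.

Context (Y : normedModType R) (q : R) (q2 : 2 < q).
Context (emb : {linear Y -> Lp Om (ge1_gt2 q2)}) (emb_cont : continuous emb).
Context (Ainv : {linear Hm1 Om -> Y}) (Ainv_cont : continuous Ainv).

Lemma solop_linear : linear (solop emb Ainv).
Proof. by move=> a u v; rewrite /solop !linearP. Qed.

Lemma solop_bounded : exists2 C, 0 <= C & forall v, `|solop emb Ainv v| <= C * `|v|.
Proof.
have [a a0 ha] := continuous_linear_bound Ainv_cont.
have [b b0 hb] := continuous_linear_bound emb_cont.
have [c c0 hc] := Lp_L2_bounded Om q2.
exists (c * (b * a)) => [|v]; first by rewrite !mulr_ge0.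
apply: le_trans (hc _) _; rewrite -!mulrA ler_wpM2l//.
apply: le_trans (hb _) _; rewrite ler_wpM2l//.
by apply: le_trans (ha _) _; rewrite ler_wpM2l// L2_Hm1_norm.
Qed.

End solution_operator.

(** * Existence and uniqueness of the equilibrium *)

Theorem theorem2p4 (R : realType)
    (* the dimension of the space is n.+1 *)
    (n : nat) (n_le3 : (n.+1 <= 3)%N) (Om : lipschitz_domain R n) (N : nat)
    (ua ub : {ffun 'I_N -> L2 Om})
    (uab : forall nu, {ae leb_on Om, forall x, ua nu x <= ub nu x})
    (yd : {ffun 'I_N -> L2 Om})
    (psi : 'rV[R]_n.+1 -> R) (psi_cont : {within closure Om, continuous psi})
    (mu : L2 Om) (mu_ge0 : {ae leb_on Om, forall x, 0 <= mu x})
    (rho : R) (rho_gt0 : 0 < rho)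
    (Y : normedModType R) (q : R) (q_gt2 : 2 < q)
    (emb : {linear Y -> Lp Om (ge1_gt2 q_gt2)})
    (emb_inj : injective emb) (emb_cont : continuous emb)
    (A : {linear Y -> Hm1 Om}) (A_cont : continuous A)
    (Ainv : Hm1 Om -> Y) (AinvK : cancel Ainv A) (AK : cancel A Ainv)
    (Ainv_cont : continuous Ainv)
    (Omn : 'I_N -> set 'rV[R]_n.+1)
    (Omn_sub : forall nu, Omn nu `<=` Om)
    (Omn_meas : forall nu, measurable (Omn nu)) :
  let S : L2 Om -> L2 Om := solop emb Ainv in
  let Z : set 'rV[R]_n.+1 := \bigcup_(nu in [set: 'I_N]) Omn nu in
  let solution (al : R) :=
    nash (fun nu u => fAL S Omn yd psi al nu u mu rho) ua ub in
  (forall al : R, 0 < al ->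
     4^-1 * \sum_(nu < N)
       opnorm (fun v => chi Z (S v - chi (Omn nu) (S v))) ^+ 2 < al ->
     exists! u : {ffun 'I_N -> L2 Om}, solution al u) /\
  (forall Om0 : set 'rV[R]_n.+1, Om0 `<=` Om -> (forall nu, Omn nu = Om0) ->
     forall al : R, 0 < al ->
     exists! u : {ffun 'I_N -> L2 Om}, solution al u).
Proof.
move=> S Z solution.
have Ainv_linear : linear Ainv by exact: (can2_linear AK AinvK).
pose Al : {linear Hm1 Om -> Y} := HB.pack Ainv
  (GRing.isLinear.Build R _ _ *:%R Ainv Ainv_linear).
pose Sl : {linear L2 Om -> L2 Om} := HB.pack S
  (GRing.isLinear.Build R _ _ *:%R S (solop_linear emb Al)).
have [C C0 SC] := @solop_bounded _ _ _ _ _ _ emb emb_cont Al Ainv_cont.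
have [St hSt] := adjoint (S := Sl) SC.
have part_i al : 0 < al ->
  4^-1 * \sum_(nu < N)
    opnorm (fun v => chi Z (S v - chi (Omn nu) (S v))) ^+ 2 < al ->
  exists! u, solution al u.
  move=> al0 small.
  have := @nash_exists_unique _ _ _ _ Sl C C0 SC Omn Omn_meas Omn_sub yd psi mu al rho
    al0 rho_gt0 St hSt ua ub uab small.
  exact.
split=> // Om0 Om0_sub OmnE al al0; apply: part_i => //.
(* With a common observation set nothing is observed by others only, so B nu = 0. *)
rewrite big1 ?mulr0// => nu _.
have ZE : Z = Om0.
  apply/seteqP; split=> [x [k _]|x x0]; first by rewrite OmnE.
  by exists nu => //; rewrite OmnE.
have mO : measurable Om0 by rewrite -(OmnE nu).
suff -> : opnorm (fun v => chi Z (S v - chi (Omn nu) (S v))) = 0 by rewrite expr0n.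
rewrite /opnorm (_ : [set _ | _ in _] = [set 0]) ?sup1//.
have B0 v : chi Z (S v - chi (Omn nu) (S v)) = 0.
  by rewrite ZE OmnE chiB// chi_sub// subrr.
apply/seteqP; split=> [_ [v _ <-]|_ ->]; first by rewrite B0 normr0.
by exists 0; rewrite /= ?B0 normr0.
Qed.
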